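(* There are absolute constants $c$ and $\kappa$ such that for every integer $d\ge 1$, every projective curve $C\subset\mathbb{P}^3_{\mathbb{Q}}$ of degree $d$ and every real $B\ge 2$ one has $$\#C(\mathbb{Q},B)\le c\,d^{\frac{3}{4}}B^2(\log B)^{\kappa}.$$
   Context: A variety in $\mathbb{P}^n_{\mathbb{Q}}$ is a reduced (closed) subscheme of $\mathbb{P}^n_{\mathbb{Q}}$, not necessarily irreducible; a curve is a variety of pure dimension $1$, and its degree is the sum of the degrees of its irreducible components. $C(\mathbb{Q},B)$ denotes the set of rational points of $C$ of height $\le B$, i.e. the points that can be written in homogeneous integer coordinates $(x_0,\dots,x_n)$ (not all zero) with $|x_0|,\dots,|x_n|\le B$. *)

(* Defs.v *)
From HB Require Import structures.
From mathcomp Require Import all_boot all_order all_algebra archimedean finmap.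
From mathcomp Require Import boolp classical_sets functions cardinality fsbigop.
From mathcomp Require Import reals exp.
From mathcomp Require Import mpoly.

Set Implicit Arguments.
Unset Strict Implicit.
Unset Printing Implicit Defensive.

Import Order.TTheory GRing.Theory Num.Theory.
Local Open Scope classical_set_scope.
Local Open Scope ring_scope.

(* Reduced closed subschemes of P^n over k correspond to the saturated
   homogeneous radical ideals of k[X_0, .., X_n]; among homogeneous radical
   ideals, saturation only excludes the irrelevant ideal (X_0, .., X_n). The unit
   ideal is allowed, and stands for the empty variety. *)

Definition is_ideal (A : nzRingType) (I : set A) : Prop :=
  I 0 /\ forall a f g, I f -> I g -> I (a * f + g).

Definition homogeneous (k : fieldType) (n : nat) (I : set {mpoly k[n]}) : Prop :=
  forall f, I f -> forall t, I (pihomog mdeg t f).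

Definition radical (A : nzRingType) (I : set A) : Prop :=
  forall f m, I (f ^+ m) -> I f.

Definition saturated (k : fieldType) (n : nat) (I : set {mpoly k[n]}) : Prop :=
  forall f, (forall i : 'I_n, I ('X_i * f)) -> I f.

Record proj_variety (k : fieldType) (n : nat) := ProjVariety {
  vanishing_ideal :> set {mpoly k[n.+1]};
  _ : is_ideal vanishing_ideal;
  _ : homogeneous vanishing_ideal;
  _ : radical vanishing_ideal;
  _ : saturated vanishing_ideal }.

(* The irreducible closed subsets of P^n correspond, with inclusions reversed,
   to the homogeneous primes not containing the irrelevant ideal. *)
Definition proj_prime (k : fieldType) (n : nat) (P : set {mpoly k[n.+1]}) : Prop :=
  [/\ idealr_closed [pred f in P], prime_idealr_closed [pred f in P], homogeneous P
    & exists i : 'I_n.+1, ~ P 'X_i].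

Definition components (k : fieldType) (n : nat) (I : set {mpoly k[n.+1]}) :
    set (set {mpoly k[n.+1]}) :=
  [set P | [/\ proj_prime P, I `<=` P
    & forall Q, proj_prime Q -> I `<=` Q -> Q `<=` P -> Q = P]].

(* Krull dimension of the closed set defined by P: chains of irreducible closed
   subsets of V(P) may be taken to start at V(P) itself, as P is prime. *)
Definition dim_ge (k : fieldType) (n : nat) (P : set {mpoly k[n.+1]}) (r : nat) :
    Prop :=
  exists c : nat -> set {mpoly k[n.+1]},
    [/\ c 0%N = P, forall i, (i <= r)%N -> proj_prime (c i)
      & forall i, (i < r)%N -> c i `<` c i.+1].

Definition has_dim (k : fieldType) (n : nat) (P : set {mpoly k[n.+1]}) (r : nat) :
    Prop :=
  dim_ge P r /\ ~ dim_ge P r.+1.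

Definition is_curve (k : fieldType) (n : nat) (C : proj_variety k n) : Prop :=
  forall P, components C P -> has_dim P 1.

(* The degree t part of I, as a subspace of the space of forms of degree t; the
   default value of xget is never reached for an ideal, see homog_partP. *)
Definition homog_part (k : fieldType) (n : nat) (I : set {mpoly k[n.+1]})
    (t : nat) : {vspace dhomog n.+1 k t} :=
  xget 0%VS [set V : {vspace dhomog n.+1 k t} |
    forall f, (f \in V) <-> I (mpoly_of_dhomog f)].

Definition hilbert_fun (k : fieldType) (n : nat) (I : set {mpoly k[n.+1]})
    (t : nat) : nat :=
  (\dim {: dhomog n.+1 k t} - \dim (homog_part I t))%N.

Definition is_hilbert_poly (k : fieldType) (n : nat) (I : set {mpoly k[n.+1]})
    (p : {poly rat}) : Prop :=
  exists N, forall t, (N <= t)%N -> p.[t%:R] = (hilbert_fun I t)%:R.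

(* Exists for every homogeneous ideal (Hilbert-Serre); unique by
   is_hilbert_poly_uniq. *)
Definition hilbert_poly (k : fieldType) (n : nat) (I : set {mpoly k[n.+1]}) :
    {poly rat} :=
  xget 0 [set p | is_hilbert_poly I p].

(* r! times the leading coefficient, with r the degree of the Hilbert
   polynomial, i.e. the dimension. *)
Definition irr_degree (k : fieldType) (n : nat) (P : set {mpoly k[n.+1]}) : rat :=
  let p := hilbert_poly P in ((size p).-1)`!%:R * lead_coef p.

(* The finitely supported sum is over all components: there are finitely many,
   polynomial rings being Noetherian. *)
Definition curve_degree (k : fieldType) (n : nat) (C : proj_variety k n) : rat :=
  \sum_(P \in components C) irr_degree P.

Definition rat_point (n : nat) : Type :=
  {L : {vspace 'rV[rat]_n.+1} | \dim L == 1%N}.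

HB.instance Definition _ (n : nat) := Choice.on (rat_point n).

Definition point_on (n : nat) (C : proj_variety rat n) (x : rat_point n) : Prop :=
  forall f, vanishing_ideal C f -> forall v, v \in val x -> f.@[v ord0] = 0.

Definition height_le (R : realType) (n : nat) (B : R) (x : rat_point n) : Prop :=
  exists a : 'rV[int]_n.+1,
    [/\ a != 0, val x = <[map_mx (intr : int -> rat) a]>%VS
      & forall i, `|(a ord0 i)%:~R| <= B].

Definition rat_points (R : realType) (n : nat) (C : proj_variety rat n) (B : R) :
    set (rat_point n) :=
  [set x | point_on C x /\ height_le B x].

Lemma homog_partP (k : fieldType) (n : nat) (I : set {mpoly k[n.+1]}) (t : nat) :
  is_ideal I ->
  forall f, (f \in homog_part I t) <-> I (mpoly_of_dhomog f).
Proof.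
case=> I0 ID.
have IZ (a : k) f : I f -> I (a *: f).
  by move=> If; rewrite -mul_mpolyC -[_ * _]addr0; apply: ID.
have IA f g : I f -> I g -> I (f + g).
  by move=> If Ig; rewrite -[f]mul1r; apply: ID.
apply: (@xgetPex _ _ [set V : {vspace dhomog n.+1 k t} |
    forall f, (f \in V) <-> I (mpoly_of_dhomog f)]).
pose sub (V : {vspace dhomog n.+1 k t}) :=
  forall f, f \in V -> I (mpoly_of_dhomog f).
pose D d := `[< exists2 V, sub V & \dim V = d >].
have D0 : exists d, D d.
  exists 0%N; apply/asboolP; exists 0%VS; last exact: dimv0.
  by move=> f; rewrite memv0 => /eqP ->; rewrite raddf0.
have Dub d : D d -> (d <= \dim {: dhomog n.+1 k t})%N.
  by move=> /asboolP [V _ <-]; exact/dimvS/subvf.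
case: (ex_maxnP D0 Dub) => d /asboolP [V subV dV] dmax.
exists V => f; split; first exact: subV.
move=> If; have subVf : sub (V + <[f]>)%VS.
  move=> g /memv_addP [u uV [w /vlineP [a ->] ->]].
  by apply: IA; [exact: subV | exact: IZ].
have dVf : (\dim (V + <[f]>) <= \dim V)%N.
  by rewrite dV; apply: dmax; apply/asboolP; exists (V + <[f]>)%VS.
have -> : V = (V + <[f]>)%VS by apply/eqP; rewrite eqEdim addvSl dVf.
exact: (subvP (addvSr _ _)) (memv_line f).
Qed.

Lemma is_hilbert_poly_uniq (k : fieldType) (n : nat) (I : set {mpoly k[n.+1]})
    (p q : {poly rat}) :
  is_hilbert_poly I p -> is_hilbert_poly I q -> p = q.
Proof.
move=> [N Np] [M Mq]; apply/eqP; rewrite -subr_eq0; apply/eqP.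
pose s := [seq (i%:R : rat) | i <- iota (N + M) (size (p - q))].
apply: (@roots_geq_poly_eq0 _ _ s).
- apply/allP => x /mapP [t]; rewrite mem_iota => /andP [tge _] ->.
  rewrite /root hornerD hornerN Np ?Mq ?subrr //.
    exact: leq_trans (leq_addl _ _) tge.
  exact: leq_trans (leq_addr _ _) tge.
- rewrite map_inj_uniq ?iota_uniq //.
  by move=> i j /eqP; rewrite eqr_nat => /eqP.
- by rewrite size_map size_iota.
Qed.

Lemma finite_rat_points (R : realType) (n : nat) (C : proj_variety rat n) (B : R) :
  finite_set (rat_points C B).
Proof.
pose N := Num.truncn B.
pose dec (a : 'rV['I_(N + N).+1]_n.+1) : {vspace 'rV[rat]_n.+1} :=
  <[map_mx (fun i : 'I_(N + N).+1 => (i%:Z - N%:Z)%:~R : rat) a]>%VS.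
have fin : finite_set [set dec a | a in [set: 'rV['I_(N + N).+1]_n.+1]].
  exact/finite_image/finite_finset.
apply: (@sub_finite_set _ _ (val @^-1` [set dec a | a in setT])); last first.
  by apply: finite_preimage => // x y _ _; exact: val_inj.
move=> x [_ [a [_ xE aB]]] /=.
have aN i : `|a ord0 i| <= N%:Z.
  have B0 : 0 <= B by exact: le_trans (normr_ge0 _) (aB i).
  by rewrite -abszE lez_nat truncn_ge_nat // pmulrn abszE intr_norm.
exists (map_mx (fun z : int => inord (absz (z + N%:Z))) a) => //.
rewrite /dec xE; congr (<[_]>%VS); apply/rowP => i; rewrite !mxE.
move: (aN i); rewrite ler_norml => /andP [lo hi].
have h0 : 0 <= a ord0 i + N%:Z by rewrite -lerBlDr sub0r.
rewrite inordK; first by rewrite gez0_abs // addrK.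
by rewrite ltnS -lez_nat gez0_abs // PoszD lerD2r.
Qed.

(* Main.v *)
Require Import Defs.
From HB Require Import structures.
From mathcomp Require Import all_boot all_order all_algebra finmap archimedean.
From mathcomp Require Import boolp classical_sets functions cardinality fsbigop.
From mathcomp Require Import reals exp.
From mathcomp Require Import mpoly.
From mathcomp Require Import zify ring lra.
Import Order.TTheory GRing.Theory Num.Theory.
Local Open Scope ring_scope.

Set Implicit Arguments.
Unset Strict Implicit.
Unset Printing Implicit Defensive.

(** The proof counts with planes only, and needs no bound for the points of an
    irreducible curve beyond Bezout's theorem for linear sections.

    Let [m] be the integer part of [B] and [D] that of the fourth root of [d]; it is
    enough to bound the number of points by a multiple of [D^3 m^2 (log m)^2]. Points
    are integer vectors with entries at most [m] in absolute value, taken up to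
    proportion. There are [O(m^4)] of them, so one may assume [D^3 < m^2]. By the
    pigeonhole principle ([siegel]) each lies on a plane of height at most
    [K = O(m^(1/3))]. Consider a point on a component [P] of degree [e].

    If that plane does not contain [P], it cuts [P] in at most [e] points, and the
    number of all such points together is [O(d K^4)], hence [O(D^3 m^2)]
    ([transverse_count]).

    If [P] lies in exactly one plane, of height [h <= K], then a second use of the
    pigeonhole principle modulo the equation of the plane covers the points of [P] by
    [O(h Y^3)] other planes with [h Y^2] about [m] ([planar_cut_count]); on the other
    hand the plane has only [O(m^3 / h)] points at all ([hyperplane_count]), and there
    are [O(H^4)] planes of height at most [H]. For [h] in a dyadic interval one of the
    two estimates is good enough, depending on how [D^2] compares with [m h]
    ([planar_class_count]).

    If [P] is a line, whose lattice has successive minima [l1 <= l2], then it has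
    [O(m^2 / (l1 l2))] points ([line_count]), and the number of such lines is at most
    [d], and also [O((l1 l2)^4)] for minima in given dyadic intervals; one uses the
    first or the second according to how [l1 l2] compares with [D]
    ([line_class_count]). The logarithms count the dyadic classes.

    It remains to see that a plane cuts a component properly in at most as many
    rational points as its degree, where the degree is read off the Hilbert polynomial
    and the dimension is defined by chains of primes. Hilbert functions are additive
    in the exact sequence attached to a form ([hilbert_fun_exact]); consequently a
    homogeneous ideal that is maximal among those whose Hilbert function is not
    eventually constant, or not eventually zero, is prime ([maximal_prime]). For a
    prime [P] of dimension one, these two cases would produce a chain of primes of
    length two unless the Hilbert function of [P] is eventually affine; its slope is
    the degree ([hilbert_fun_dim1], [irr_degree_dim1]) and also the eventual value of
    the Hilbert function of each plane section, which is an upper bound for the number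
    of points there ([points_le_hilbert]). Zorn's lemma puts every point of the curve
    on a component ([minimal_prime_below]). *)

(** * Integer vectors and Siegel's lemma *)

Section Vectors.
Variable n : nat.
Implicit Types (u v w x b : 'rV[int]_n) (k : 'I_n -> nat).

Lemma vecP u v : (forall i, u 0 i = v 0 i) -> u = v.
Proof. by move=> H; apply/rowP => i; exact: H. Qed.

Definition dot u v : int := \sum_i u 0%R i * v 0%R i.

Definition supnorm u : nat := \max_i `|u 0%R i|%N.

(** All 2 x 2 minors vanish: for nonzero vectors, equality of the projective points. *)
Definition parallel u v : bool :=
  [forall i, forall j, u 0%R i * v 0%R j == u 0%R j * v 0%R i].

Definition in_box k u : bool := [forall i, (`|u 0%R i| <= k i)%N].

Definition box k : seq 'rV[int]_n :=
  [seq \row_i ((f i : nat)%:Z - (k i)%:Z) | f : {dffun forall i, 'I_((k i).*2.+1)}].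

Lemma size_box k : size (box k) = (\prod_i (k i).*2.+1)%N.
Proof.
rewrite size_map -cardE card_dep_ffun foldrE big_map big_enum /=.
by apply: eq_bigr => i _; rewrite card_ord.
Qed.

Lemma mem_box k u : in_box k u -> u \in box k.
Proof.
move=> /forallP ub; apply/mapP.
exists [ffun i => inord (absz (u 0%R i + (k i)%:Z))]; first exact: mem_enum.
apply/vecP => i; rewrite !mxE ffunE.
by rewrite inordK; move: (ub i); lia.
Qed.

Lemma size_in_box k (X : seq 'rV[int]_n) :
  uniq X -> all (in_box k) X -> (size X <= \prod_i (k i).*2.+1)%N.
Proof.
move=> uX /allP X_in; rewrite -size_box; apply: uniq_leq_size uX _.
by move=> x /X_in; exact: mem_box.
Qed.

Lemma supnorm_leP u m : reflect (forall i, (`|u 0%R i| <= m)%N) (supnorm u <= m)%N.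
Proof. by apply: (iffP (bigmax_leqP _ _ _)) => H i; [exact: H | move=> _; exact: H]. Qed.

Lemma le_supnorm u i : (`|u 0%R i| <= supnorm u)%N.
Proof. exact: (supnorm_leP _ _ (leqnn _)). Qed.

Lemma supnorm_eq0 u : (supnorm u == 0%N) = (u == 0).
Proof.
apply/eqP/eqP => [u0|->].
  apply/vecP => i; rewrite mxE; have := le_supnorm u i; rewrite u0; lia.
by apply/eqP; rewrite -leqn0; apply/supnorm_leP => i; rewrite mxE.
Qed.

Lemma supnorm_attained u : u != 0 -> exists i, `|u 0%R i|%N = supnorm u.
Proof.
move=> u0; have [/existsP [i /eqP]|/existsPn H] :=
  boolP [exists i, `|u 0%R i|%N == supnorm u]; first by exists i.
have hu : (0 < supnorm u)%N by rewrite lt0n supnorm_eq0.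
have : (supnorm u <= (supnorm u).-1)%N.
  by apply/supnorm_leP => i; move: (H i) (le_supnorm u i); lia.
by lia.
Qed.

Lemma parallelP u v :
  reflect (forall i j, u 0%R i * v 0%R j = u 0%R j * v 0%R i) (parallel u v).
Proof.
apply: (iffP forallP) => [H i j|H i]; first by have /forallP /(_ j) /eqP := H i.
by apply/forallP => j; apply/eqP.
Qed.

Lemma parallel_refl u : parallel u u.
Proof. by apply/parallelP => i j; rewrite mulrC. Qed.

Lemma parallel_sym u v : parallel u v = parallel v u.
Proof. by apply/parallelP/parallelP => H i j; rewrite mulrC H mulrC. Qed.

Lemma parallel0 u : parallel 0 u.
Proof. by apply/parallelP => i j; rewrite !mxE !mul0r. Qed.

Lemma dotDl u v x : dot (u + v) x = dot u x + dot v x.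
Proof. by rewrite -big_split; apply: eq_bigr => i _; rewrite mxE mulrDl. Qed.
Lemma dotC u v : dot u v = dot v u.
Proof. by apply: eq_bigr => i _; rewrite mulrC. Qed.
Lemma dotZl a u v : dot (a *: u) v = a * dot u v.
Proof. by rewrite mulr_sumr; apply: eq_bigr => i _; rewrite mxE mulrA. Qed.
Lemma dotBl u v x : dot (u - v) x = dot u x - dot v x.
Proof. by rewrite dotDl -scaleN1r dotZl mulN1r. Qed.
Lemma dotDr u v x : dot x (u + v) = dot x u + dot x v.
Proof. by rewrite dotC dotDl !(dotC x). Qed.
Lemma dotBr u v x : dot x (u - v) = dot x u - dot x v.
Proof. by rewrite dotC dotBl !(dotC x). Qed.
Lemma dotZr a u v : dot v (a *: u) = a * dot v u.
Proof. by rewrite dotC dotZl dotC. Qed.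
Lemma dot_delta u i : dot u (delta_mx 0%R i) = u 0%R i.
Proof.
rewrite /dot (bigD1 i) //= big1 ?addr0; first by rewrite !mxE !eqxx mulr1.
by move=> j /negPf ji; rewrite mxE ji andbF mulr0.
Qed.

(** The pigeonhole principle: more vectors of the box [0, k] than values of
    their product with [x], so that two of them have a difference orthogonal
    to [x]. *)
Lemma siegel x k m : (supnorm x <= m)%N ->
  (2 * (\sum_i k i) * m + 1 < \prod_i (k i).+1)%N ->
  exists2 b, b != 0 & in_box k b /\ dot b x = 0.
Proof.
move=> /supnorm_leP xm hk; set S := (\sum_i k i)%N in hk.
pose T := {dffun forall i : 'I_n, 'I_(k i).+1}.
pose vec (f : T) : 'rV[int]_n := \row_i (f i : nat)%:Z.
have cardT : #|{: T}| = (\prod_i (k i).+1)%N.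
  rewrite card_dep_ffun foldrE big_map big_enum /=.
  by apply: eq_bigr => i _; rewrite card_ord.
have dotb f : `|dot (vec f) x| <= (S * m)%N%:Z.
  apply: le_trans (ler_norm_sum _ _ _) _.
  rewrite /S big_distrl /= (big_morph Posz PoszD (erefl _)).
  apply: ler_sum => i _; rewrite normrM mxE.
  have := ltn_ord (f i); have := xm i; nia.
pose val (f : T) : 'I_(2 * (S * m)).+1 := inord (absz (dot (vec f) x + (S * m)%N%:Z)).
have [inj_val|] := boolP (injectiveb val).
  have := leq_card _ (injectiveP _ inj_val); rewrite card_ord leqNgt.
  by rewrite cardT mulnA -addn1 hk.
move=> /injectivePn [f [g fg eq_val]].
exists (vec f - vec g).
  apply: contra_neq fg => /rowP e; apply/ffunP => i; apply/val_inj => /=.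
  by have /eqP := e i; rewrite !mxE subr_eq0 => /eqP [].
split.
  apply/forallP => i; rewrite !mxE.
  move: (nat_of_ord (f i)) (nat_of_ord (g i)) (ltn_ord (f i)) (ltn_ord (g i)).
  lia.
move: (congr1 (@nat_of_ord _) eq_val).
rewrite !inordK; [|move: (dotb g); lia|move: (dotb f); lia].
by rewrite dotBl; move: (dotb f) (dotb g); lia.
Qed.
End Vectors.

(** * Lattice points of hyperplanes and lines *)

Lemma size_cover (T U : Type) (X : seq T) (J : seq U) (r : U -> pred T) :
  all (fun x => has (r^~ x) J) X ->
  (size X <= \sum_(j <- J) count (r j) X)%N.
Proof.
elim: X => [|x X IH] /=; first by [].
move=> /andP [xJ /IH le_X]; rewrite -addn1 addnC big_split /=.
apply: leq_add le_X; elim: J xJ {IH} => [|j J IHJ] //=.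
by rewrite big_cons; case: (r j x) => //= /IHJ.
Qed.

Section Bezout.
Variable n : nat.
Implicit Types (u v b : 'rV[int]_n).

(** Bezout: among the values of [dot b] the nonzero one of least absolute value
    divides every entry of [b]. *)
Lemma dot_gcd b : b != 0 ->
  exists u c, dot b u != 0 /\ b = dot b u *: c.
Proof.
move=> b0; have [i bi] := supnorm_attained b0.
have exP : exists m, `[< exists u, absz (dot b u) = m.+1 >].
  exists (supnorm b).-1; apply/asboolP; exists (delta_mx 0 i).
  by rewrite dot_delta bi prednK // lt0n supnorm_eq0.
case: (ex_minnP exP) => m /asboolP [u um] min_m.
have bu0 : dot b u != 0 by apply/eqP => e; move: um; rewrite e.
exists u, (\row_j (b 0%R j %/ dot b u)%Z); split=> //.
apply/vecP => j; rewrite !mxE mulrC; apply/esym/divzK.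
case: (eqVneq (b 0%R j %% dot b u)%Z 0) => [/dvdz_mod0P //|r0].
have rlt := ltz_mod (b 0 j) bu0; have rge := modz_ge0 (b 0 j) bu0.
have /min_m : `[< exists v, absz (dot b v) = (absz (b 0%R j %% dot b u)%Z).-1.+1 >].
  apply/asboolP; exists (delta_mx 0 j - (b 0%R j %/ dot b u)%Z *: u).
  rewrite dotBr dotZr dot_delta {1}(divz_eq (b 0 j) (dot b u)).
  by rewrite addrAC subrr add0r prednK // lt0n absz_eq0.
by move: rlt rge r0 um; lia.
Qed.

(** The [h] translates of [X] by the vectors [t * u] reduced modulo [h] are disjoint even after the coordinate [i] is forgotten: the
    residue of [dot b] modulo [h] does not see that coordinate and recovers [t],
    and then [dot b x = 0] recovers the entry [i] of [x]. So [h * size X] vectors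
    lie in a box of dimension [n - 1], which saves the factor [h] over the count
    that uses the other coordinates alone. *)
Lemma hyperplane_count (b u : 'rV[int]_n) (i : 'I_n) (m h : nat) (X : seq 'rV[int]_n) :
  dot b u = 1 -> absz (b 0 i) = h -> (0 < h)%N -> uniq X ->
  (forall x, x \in X -> dot b x = 0 /\ (supnorm x <= m)%N) ->
  (size X * h <= (2 * (m + h)).+1 ^ n.-1)%N.
Proof.
move=> bu bi h0 uX HX.
pose y (x : 'rV[int]_n) (t : 'I_h) : 'rV[int]_n :=
  \row_j (if j == i then 0 else x 0 j + ((t : nat)%:Z * u 0%R j %% h)%Z).
have dvd_bi : (h%:Z %| b 0%R i)%Z by rewrite -bi dvdzE.
have doty x t : x \in X -> (dot b (y x t) = t %[mod h])%Z.
  move=> /HX [bx _]; apply/eqP; rewrite eqz_mod_dvd.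
  have -> : (t : nat)%:Z = dot b (x + (t : nat)%:Z *: u).
    by rewrite dotDr dotZr bx bu add0r mulr1.
  rewrite -dotBr; apply: rpred_sum => j _; rewrite !mxE.
  case: eqP => [->|_]; first by rewrite dvdz_mulr.
  rewrite dvdz_mull // opprD addrACA subrr add0r.
  by rewrite /modz addrAC subrr sub0r -mulNr dvdz_mull.
pose Y := [seq y x t | x <- X, t <- enum 'I_h].
have uY : uniq Y.
  apply: allpairs_uniq => //; first exact: enum_uniq.
  move=> [x1 t1] [x2 t2] /allpairsP [[x3 t3] [/= x1X _ [-> ->]]].
  move=> /allpairsP [[x4 t4] [/= x2X _ [-> ->]]] {x1 x2 t1 t2} e.
  have tt : t3 = t4.
    apply/val_inj; have /eqP := doty _ t3 x1X; rewrite e doty // !modz_nat eqz_nat.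
    by rewrite !modn_small // => /eqP.
  subst t4; congr pair; apply/vecP => j.
  have xx k : k != i -> x3 0 k = x4 0 k.
    by move=> ki; move/rowP: e => /(_ k); rewrite !mxE (negPf ki) => /addIr.
  have [->|/xx //] := eqVneq j i.
  have [b3 _] := HX _ x1X; have [b4 _] := HX _ x2X.
  move: b4; rewrite -b3 /dot (bigD1 i) //= [in RHS](bigD1 i) //=.
  rewrite (eq_bigr (fun k => b 0 k * x3 0 k)) => [/addIr/mulfI -> //|k /xx ->//].
  by rewrite -absz_eq0 bi -lt0n.
pose k j := if j == i then 0%N else (m + h)%N.
have : (size Y <= \prod_j (k j).*2.+1)%N.
  apply: size_in_box uY _; apply/allP => _ /allpairsP [[x t] [/= xX _ ->]].
  apply/forallP => j; rewrite !mxE /k; case: eqP => [//|_].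
  have [_ /supnorm_leP /(_ j)] := HX _ xX; move: (x 0 j) => z.
  have h0' : (h%:Z != 0) by case: (h) h0.
  move: (ltz_mod ((t : nat)%:Z * u 0 j) h0') (modz_ge0 ((t : nat)%:Z * u 0 j) h0').
  by lia.
rewrite size_allpairs -cardE card_ord (bigD1 i) //= {1}/k eqxx mul1n.
rewrite (eq_bigr (fun=> (2 * (m + h)).+1)) => [|j /negPf ji]; last first.
  by rewrite /k ji mul2n.
by rewrite prod_nat_const cardC1 card_ord.
Qed.
End Bezout.

Section Lines.
Implicit Types (n : nat).

Lemma cramer2 (F : fieldType) (p q x y x' y' : F) :
  p * x + q * y = 0 -> p * x' + q * y' = 0 -> x * y' - x' * y != 0 ->
  p = 0 /\ q = 0.
Proof.
move=> e e' d0; split; apply: (mulIf d0); rewrite mul0r.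
  have -> : p * (x * y' - x' * y) = (p * x + q * y) * y' - (p * x' + q * y') * y.
    by ring.
  by rewrite e e' !mul0r subrr.
have -> : q * (x * y' - x' * y) = (p * x' + q * y') * x - (p * x + q * y) * x'.
  by ring.
by rewrite e e' !mul0r subrr.
Qed.

Lemma nparallel_row_free n (b c : 'rV[int]_n) : ~~ parallel b c ->
  row_free (col_mx (map_mx (intr : int -> rat) b) (map_mx intr c)).
Proof.
move=> bc; apply: inj_row_free => w; rewrite -[w]hsubmxK mul_row_col => e.
have {}e i : lsubmx w 0 0 * (b 0 i)%:~R + rsubmx w 0 0 * (c 0 i)%:~R = 0.
  by move/rowP/(_ i): e; rewrite !mxE !big_ord1 !mxE.
have /forallPn [i /forallPn [j bij]] := bc.
have d0 : (b 0 i)%:~R * (c 0 j)%:~R - (b 0 j)%:~R * (c 0 i)%:~R != 0 :> rat.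
  by rewrite -!intrM subr_eq0 eqr_int.
have [p0 q0] := cramer2 (e i) (e j) d0.
have -> : lsubmx w = 0 by apply/rowP => k; rewrite ord1 [RHS]mxE.
have -> : rsubmx w = 0 by apply/rowP => k; rewrite ord1 [RHS]mxE.
exact: row_mx0.
Qed.

Lemma line_span (b c u v x : 'rV[int]_4) : ~~ parallel b c -> ~~ parallel u v ->
  (forall y, y \in [:: u; v; x] -> dot b y = 0 /\ dot c y = 0) ->
  exists p q : rat, forall i, (x 0 i)%:~R = p * (u 0 i)%:~R + q * (v 0 i)%:~R.
Proof.
move=> bc uv H; pose I := map_mx (intr : int -> rat).
pose A := (col_mx (I _ _ b) (I _ _ c))^T; pose U := col_mx (I _ _ u) (I _ _ v).
have rU : \rank U = 2%N by apply/eqP; exact: nparallel_row_free.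
have rA : \rank A = 2%N by rewrite mxrank_tr; apply/eqP; exact: nparallel_row_free.
have killA y : y \in [:: u; v; x] -> I _ _ y *m A = 0.
  move=> /H [by0 cy0]; rewrite /A tr_col_mx mul_mx_row.
  have dotE (d : 'rV[int]_4) : dot d y = 0 -> I _ _ y *m (I _ _ d)^T = 0.
    move=> dy; apply/rowP => k; rewrite ord1 !mxE.
    have : ((dot d y)%:~R : rat) = 0 by rewrite dy.
    rewrite /dot rmorph_sum /= => {2}<-; apply: eq_bigr => i _.
    by rewrite !mxE intrM mulrC.
  by rewrite !dotE ?row_mx0.
have UA : (U <= kermx A)%MS.
  by apply/sub_kermxP; rewrite mul_col_mx !killA ?col_mx0 // !inE eqxx ?orbT.
have xA : (I _ _ x <= kermx A)%MS.
  by apply/sub_kermxP; rewrite killA // !inE eqxx !orbT.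
have kU : (kermx A <= U)%MS.
  by rewrite -(geq_leqif (mxrank_leqif_sup UA)) mxrank_ker rA rU.
have /submxP [D xD] := submx_trans xA kU.
exists (lsubmx D 0 0), (rsubmx D 0 0) => i.
move/rowP/(_ i): xD; rewrite mxE => ->.
by rewrite -[D in LHS]hsubmxK mul_row_col !mxE !big_ord1 !mxE.
Qed.
End Lines.

Lemma coord_le_supnorm n (x : 'rV[int]_n) (k : nat) i :
  (supnorm x <= k)%N -> `|(x 0 i)%:~R : rat| <= k%:R.
Proof. by move=> /supnorm_leP /(_ i) xk; rewrite -intr_norm -abszE -pmulrn ler_nat. Qed.

Lemma supnorm_lt n (x : 'rV[int]_n) (k : nat) : (0 < k)%N ->
  (forall i, `|(x 0 i)%:~R : rat| < k%:R) -> (supnorm x < k)%N.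
Proof.
case: k => // k _ H; rewrite ltnS; apply/supnorm_leP => i; have := H i.
by rewrite -intr_norm -abszE -pmulrn ltr_nat ltnS.
Qed.

Lemma absz_floor_le (r : rat) (e k : nat) : (0 < e)%N -> `|r| * e%:R <= k%:R ->
  (`|Num.floor r| <= (k %/ e).+1)%N.
Proof.
move=> e0 rk; have e0' : 0 < e%:R :> rat by rewrite ltr0n.
have kq : k%:R < ((k %/ e).+1)%:R * e%:R :> rat.
  by rewrite -natrM ltr_nat ltn_ceil.
have : `|r| < ((k %/ e).+1)%:R by rewrite -(ltr_pM2r e0'); apply: le_lt_trans kq.
move: (k %/ e).+1 => K {kq rk e0 e0'} rK; have /andP [f1 f2] := floor_itv r.
have : (- K%:Z - 1)%:~R < (Num.floor r)%:~R :> rat.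
  move: rK f2; rewrite ltr_norml intrB intrN intrD -pmulrn => /andP [? ?] ?; lra.
have : (Num.floor r)%:~R < K%:Z%:~R :> rat.
  move: rK; rewrite ltr_norml -pmulrn => /andP [? ?]; lra.
by rewrite !ltr_int; move: (Num.floor r) => z; lia.
Qed.

Lemma inord_shift_inj (k : nat) (z z' : int) : (`|z| <= k)%N -> (`|z'| <= k)%N ->
  inord (absz (z + k%:Z)) = inord (absz (z' + k%:Z)) :> 'I_(2 * k).+1 -> z = z'.
Proof. by move=> zk z'k /(congr1 val) /=; rewrite !inordK; lia. Qed.

(** The vectors realise the successive minima of the rank two lattice of all [x]
    with [dot b x = dot c x = 0]. *)
Definition successive_minima (b c v1 v2 : 'rV[int]_4) : Prop :=
  let W x := dot b x = 0 /\ dot c x = 0 in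
  [/\ ~~ parallel b c, W v1 /\ W v2, ~~ parallel v1 v2,
    forall y, W y -> y != 0 -> (supnorm v1 <= supnorm y)%N
  & forall y, W y -> ~~ parallel v1 y -> (supnorm v2 <= supnorm y)%N].

(** In the rational coordinates [(p, q)] of the lattice over [(v1, v2)], two points
    of one cell of side 1/2 have a difference of norm less than [supnorm v2], hence
    parallel to [v1], hence of norm less than [supnorm v1], hence zero. Minimality
    also bounds the coordinates by [2m / supnorm v2] and [3m / supnorm v1], and
    there are as many points as cells. *)
Lemma line_count (b c v1 v2 : 'rV[int]_4) (m : nat) (X : seq 'rV[int]_4) :
  successive_minima b c v1 v2 -> (supnorm v2 <= m)%N -> uniq X ->
  (forall x, x \in X -> (dot b x = 0 /\ dot c x = 0) /\ (supnorm x <= m)%N) ->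
  (size X * (supnorm v1 * supnorm v2) <= 165 * m ^ 2)%N.
Proof.
move=> [bc [Wv1 Wv2] v12 min1 min2] v2m uX HX.
pose W x := dot b x = 0 /\ dot c x = 0.
have v10 : v1 != 0 by apply: contraNneq v12 => ->; exact: parallel0.
have v20 : v2 != 0 by apply: contraNneq v12 => ->; rewrite parallel_sym parallel0.
have h12 : (supnorm v1 <= supnorm v2)%N by exact: min1.
have h10 : (0 < supnorm v1)%N by rewrite lt0n supnorm_eq0.
set a := supnorm v1 in h10 h12 *; set d := supnorm v2 in h12 v2m *.
have a0 : 0 < a%:R :> rat by rewrite ltr0n.
have d0 : 0 < d%:R :> rat by rewrite ltr0n (leq_trans h10).
have ad : a%:R <= d%:R :> rat by rewrite ler_nat.
have WB x y : W x -> W y -> W (x - y).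
  by move=> [bx cx] [by0 cy]; rewrite /W !dotBr bx cx by0 cy subrr.
have WZ k x : W x -> W (k *: x).
  by move=> [bx cx]; rewrite /W !dotZr bx cx mulr0.
have WD x y : W x -> W y -> W (x + y).
  by move=> [bx cx] [by0 cy]; rewrite /W !dotDr bx cx by0 cy addr0.
have /choice [co coE] : forall x, exists pq : rat * rat, W x ->
    forall i, (x 0 i)%:~R = pq.1 * (v1 0 i)%:~R + pq.2 * (v2 0 i)%:~R.
  move=> x; have [Wx|nWx] := pselect (W x); last by exists (0, 0).
  have [|p [q pq]] := @line_span b c v1 v2 x bc v12; last by exists (p, q).
  by move=> y; rewrite !inE => /or3P [] /eqP ->.
have q_le x : W x -> (supnorm x <= m)%N -> `|(co x).2| * d%:R <= 2 * m%:R.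
  move=> Wx xm; have xE := coE x Wx; set p := (co x).1 in xE; set q := (co x).2 in xE *.
  have [->|q0] := eqVneq q 0; first by rewrite normr0 mul0r mulr_ge0.
  (* w is the point v1 * p / q + v2 with its first coordinate rounded: it is at
     distance at most |v1| / 2 <= |v2| / 2 from x / q, and its norm is at least |v2|. *)
  pose g := Num.floor (p / q + 1 / 2); pose w := v2 + g *: v1.
  have Ww : W w by apply: WD => //; exact: WZ.
  have nw : ~~ parallel v1 w.
    apply: contra v12 => /parallelP H; apply/parallelP => i j; have := H i j.
    by rewrite !mxE !mulrDr !mulrA [v1 0 i * g * _]mulrAC [v1 0 j * g * _]mulrAC
       [v1 0 j * v1 0 i]mulrC => /addIr.
  have wd := min2 _ Ww nw; rewrite -/d in wd.
  have [i wi] : exists i, `|w 0%R i|%N = supnorm w.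
    by apply: supnorm_attained; rewrite -supnorm_eq0 -lt0n (leq_trans _ wd) // -(ltr0n rat).
  have : d%:R <= `|(w 0 i)%:~R : rat|.
    by rewrite -intr_norm -abszE -pmulrn ler_nat wi.
  have -> : (w 0 i)%:~R = (x 0 i)%:~R / q + (g%:~R - p / q) * (v1 0 i)%:~R.
    by rewrite xE !mxE intrD intrM; field.
  have gp : `|g%:~R - p / q| <= 1 / 2.
    have /andP [g1 g2] := floor_itv (p / q + 1 / 2); rewrite -/g in g1 g2.
    by rewrite intrD in g2; rewrite ler_norml; apply/andP; split; lra.
  move=> /le_trans /(_ (ler_normD _ _)); rewrite !normrM normfV => dle.
  have v1i := coord_le_supnorm i (leqnn a).
  have {dle}dle : d%:R <= m%:R / `|q| + 1 / 2 * a%:R.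
    apply: le_trans dle _; apply: lerD.
      by rewrite ler_wpM2r ?invr_ge0 // coord_le_supnorm.
    by apply: ler_pM.
  have {dle}dle : d%:R / 2 <= m%:R / `|q| by lra.
  have qq : 0 < `|q| by rewrite normr_gt0.
  move: dle; rewrite ler_pdivlMr //; lra.
have p_le x : W x -> (supnorm x <= m)%N -> `|(co x).1| * a%:R <= 3 * m%:R.
  move=> Wx xm; have xE := coE x Wx; have := q_le x Wx xm.
  set p := (co x).1 in xE *; set q := (co x).2 in xE *.
  move=> qd; have [i v1i] := supnorm_attained v10.
  have <- : `|(v1 0 i)%:~R : rat| = a%:R by rewrite -intr_norm -abszE -pmulrn v1i.
  rewrite -normrM.
  have -> : p * (v1 0 i)%:~R = (x 0 i)%:~R - q * (v2 0 i)%:~R by rewrite xE addrK.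
  apply: le_trans (ler_normB _ _) _; rewrite normrM.
  have := coord_le_supnorm i xm; have := coord_le_supnorm i (leqnn d).
  move=> v2i xi; have : `|q| * `|(v2 0 i)%:~R| <= `|q| * d%:R by rewrite ler_wpM2l.
  lra.
pose P := ((6 * m) %/ a).+1; pose Q := ((4 * m) %/ d).+1.
pose cell x : int * int := (Num.floor (2 * (co x).1), Num.floor (2 * (co x).2)).
have inj_cell : {in X &, injective cell}.
  move=> x x' /HX [Wx _] /HX [Wx' _] [].
  have := floor_itv (2 * (co x).1); have := floor_itv (2 * (co x').1).
  have := floor_itv (2 * (co x).2); have := floor_itv (2 * (co x').2).
  move=> /andP [l1 u1] /andP [l2 u2] /andP [l3 u3] /andP [l4 u4] e1 e2.
  rewrite e1 in l4 u4; rewrite e2 in l2 u2.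
  rewrite !intrD in u1 u2 u3 u4.
  pose y := x - x'; have Wy : W y by exact: WB.
  pose dp := (co x).1 - (co x').1; pose dq := (co x).2 - (co x').2.
  have dp1 : `|dp| < 1 / 2 by rewrite ltr_norml /dp; apply/andP; split; lra.
  have dq1 : `|dq| < 1 / 2 by rewrite ltr_norml /dq; apply/andP; split; lra.
  have yE i : (y 0 i)%:~R = dp * (v1 0 i)%:~R + dq * (v2 0 i)%:~R.
    by rewrite !mxE intrB (coE x) // (coE x') // /dp /dq; ring.
  apply/eqP; rewrite -subr_eq0 -/y; apply: contraT => y0.
  have yd : (supnorm y < d)%N.
    apply: supnorm_lt => [|i]; first by rewrite -(ltr0n rat).
    rewrite yE; apply: le_lt_trans (ler_normD _ _) _; rewrite !normrM.
    have A : `|dp| * `|(v1 0 i)%:~R| <= `|dp| * a%:R by rewrite ler_wpM2l ?coord_le_supnorm.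
    have B : `|dq| * `|(v2 0 i)%:~R| <= `|dq| * d%:R by rewrite ler_wpM2l ?coord_le_supnorm.
    have A' : `|dp| * a%:R < 1 / 2 * a%:R by rewrite ltr_pM2r.
    have B' : `|dq| * d%:R < 1 / 2 * d%:R by rewrite ltr_pM2r.
    lra.
  have py : parallel v1 y by apply: contraLR yd => /min2 - /(_ Wy); rewrite leqNgt.
  have dq0 : dq = 0.
    apply: contraNeq v12 => q0; apply/parallelP => i j; move/parallelP: py => /(_ i j) /eqP.
    rewrite -(eqr_int rat) !intrM !yE => /eqP H; apply/eqP.
    rewrite -(eqr_int rat) !intrM; apply/eqP; apply: (mulfI q0); move: H.
    set x1 := (v1 0 i)%:~R; set x2 := (v1 0 j)%:~R; set x3 := (v2 0 i)%:~R.
    set x4 := (v2 0 j)%:~R => H.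
    have -> : dq * (x1 * x4) = x1 * (dp * x2 + dq * x4) - dp * x1 * x2 by ring.
    by rewrite H; ring.
  have : (supnorm y < a)%N.
    apply: supnorm_lt => // i; rewrite yE dq0 mul0r addr0 normrM.
    have A : `|dp| * `|(v1 0 i)%:~R| <= `|dp| * a%:R by rewrite ler_wpM2l ?coord_le_supnorm.
    have A' : `|dp| * a%:R < 1 / 2 * a%:R by rewrite ltr_pM2r.
    lra.
  by rewrite ltnNge min1.
pose cellN x : 'I_(2 * P).+1 * 'I_(2 * Q).+1 :=
  (inord (absz ((cell x).1 + P%:Z)), inord (absz ((cell x).2 + Q%:Z))).
have cell_le x : x \in X -> (`|(cell x).1| <= P)%N /\ (`|(cell x).2| <= Q)%N.
  move=> /HX [Wx xm]; split; apply: absz_floor_le => //.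
  - rewrite normrM -mulrA natrM; have := p_le x Wx xm; rewrite ger0_norm //; lra.
  - by rewrite -(ltr0n rat).
  - rewrite normrM -mulrA natrM; have := q_le x Wx xm; rewrite ger0_norm //; lra.
have : (size X <= (2 * P).+1 * (2 * Q).+1)%N.
  rewrite -[X in (_ <= X * _)%N]card_ord -[X in (_ <= _ * X)%N]card_ord -card_prod.
  rewrite -(size_map cellN) cardE; apply: uniq_leq_size; last by move=> *; rewrite mem_enum.
  rewrite map_inj_in_uniq // => x x' xX x'X [] e1 e2.
  have [A1 A2] := cell_le x xX; have [B1 B2] := cell_le x' x'X.
  apply: inj_cell => //; rewrite [LHS]surjective_pairing [RHS]surjective_pairing;
    congr pair.
    exact: (inord_shift_inj A1 B1 e1).
  exact: (inord_shift_inj A2 B2 e2).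
have cells z e k : (e <= m -> z * e <= k * m -> (2 * z.+1).+1 * e <= (2 * k + 3) * m)%N.
  by clear; nia.
have Pa : ((2 * P).+1 * a <= 15 * m)%N.
  exact: cells (leq_trans h12 v2m) (leq_divM _ _).
have Qd : ((2 * Q).+1 * d <= 11 * m)%N by exact: cells v2m (leq_divM _ _).
move=> le_X; apply: (@leq_trans (((2 * P).+1 * a) * ((2 * Q).+1 * d))%N).
  by rewrite mulnACA leq_mul2r le_X orbT.
by apply: leq_trans (leq_mul Pa Qd) _; rewrite mulnACA.
Qed.

(** * Curves as incidence data *)

Definition proj_seq n (X : seq 'rV[int]_n) : bool :=
  all (fun x => x != 0) X && pairwise (fun u v => ~~ parallel u v) X.

Lemma proj_seq_filter n (a : pred 'rV[int]_n) X : proj_seq X -> proj_seq (filter a X).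
Proof.
move=> /andP [/allP X0 Xp]; rewrite /proj_seq pairwise_filter // andbT.
by apply/allP => x; rewrite mem_filter => /andP [_ /X0].
Qed.

Lemma proj_seq_neq0 n (X : seq 'rV[int]_n) x : proj_seq X -> x \in X -> x != 0.
Proof. by move=> /andP [/allP X0 _] /X0. Qed.

Lemma proj_seq_uniq n (X : seq 'rV[int]_n) : proj_seq X -> uniq X.
Proof.
move=> /andP [_]; rewrite uniq_pairwise; apply: sub_pairwise => u v /=.
by apply: contraNneq => ->; exact: parallel_refl.
Qed.

Lemma parallel_trans n (v u w : 'rV[int]_n) : v != 0 ->
  parallel u v -> parallel v w -> parallel u w.
Proof.
move=> v0 uv vw; have [k vk] := supnorm_attained v0.
have vk0 : v 0 k != 0 by rewrite -absz_eq0 vk supnorm_eq0.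
apply/parallelP => i j; apply: (mulfI vk0).
move/parallelP: uv => uv; move/parallelP: vw => vw.
by rewrite mulrCA (vw k j) mulrA (uv i j) -mulrA (vw i k) mulrCA.
Qed.

Lemma floor_root k n : (0 < k)%N -> exists r, (r ^ k <= n < r.+1 ^ k)%N.
Proof.
move=> k0; have ex0 : exists r, (r ^ k <= n)%N by exists 0%N; rewrite exp0n.
have ub r : (r ^ k <= n)%N -> (r <= n)%N.
  by apply: leq_trans; case: r => // r; rewrite -[X in (X <= _)%N]expn1 leq_pexp2l.
case: (ex_maxnP ex0 ub) => r rn rmax; exists r; rewrite rn ltnNge.
by apply/negP => /rmax; rewrite ltnn.
Qed.

(** All that the count needs of a curve with components [s]: [V P] holds for the
    vectors of the points of [P], [F P] for the integer linear forms that vanish on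
    [P], and [e P] is the degree. *)
Record incidence (I : eqType) (s : seq I) (e : I -> nat) (V F : I -> pred 'rV[int]_4) :
    Prop := Incidence {
  deg_gt0 : forall P, P \in s -> (0 < e P)%N;
  forms_vanish : forall P b x, P \in s -> F P b -> V P x -> dot b x = 0;
  section_bound : forall P b X, P \in s -> ~~ F P b -> proj_seq X -> all (V P) X ->
    all (fun x => dot b x == 0) X -> (size X <= e P)%N;
  forms_saturated : forall P b c k l, P \in s -> F P b -> k != 0 -> k *: c = l *: b -> F P c }.

Section Counting.
Variables (I : eqType) (s : seq I) (e : I -> nat) (V F : I -> pred 'rV[int]_4).
Hypothesis inc : incidence s e V F.

Lemma cut_cover P X J : P \in s -> proj_seq X -> all (V P) X ->
  all (fun x => has (fun b => ~~ F P b && (dot b x == 0)) J) X ->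
  (size X <= size J * e P)%N.
Proof.
move=> Ps pX XV XJ; apply: leq_trans (size_cover XJ) _.
rewrite -sum1_size big_distrl /=; apply: leq_sum => b _; rewrite mul1n.
have [Fb|Fb] := boolP (F P b); first by rewrite (eq_count (a2 := pred0)) ?count_pred0.
rewrite -size_filter; apply: (section_bound inc) Fb _ _ _ => //; first exact: proj_seq_filter.
  by apply/allP => x; rewrite mem_filter => /andP [_]; apply: (allP XV).
by apply/allP => x; rewrite mem_filter => /andP [].
Qed.

Definition cube N : seq 'rV[int]_4 := box (fun=> N).

Lemma size_cube N : size (cube N) = ((N.*2.+1) ^ 4)%N.
Proof. by rewrite size_box prod_nat_const card_ord. Qed.

Lemma mem_cube N u : (supnorm u <= N)%N -> u \in cube N.
Proof. by move=> /supnorm_leP uN; apply: mem_box; apply/forallP. Qed.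

Lemma transverse_count K X (s' : seq I) : {subset s' <= s} -> proj_seq X ->
  (forall x, x \in X -> exists P, [/\ P \in s', V P x
     & exists b, [/\ (supnorm b <= K)%N, ~~ F P b & dot b x = 0]]) ->
  (size X <= (K.*2.+1) ^ 4 * \sum_(P <- s') e P)%N.
Proof.
move=> ss pX H.
pose r P x := V P x && has (fun b => ~~ F P b && (dot b x == 0)) (cube K).
have cov : all (fun x => has (r^~ x) s') X.
  apply/allP => x /H [P [Ps' Vx [b [bK Fb bx]]]].
  apply/hasP; exists P => //; rewrite /r Vx; apply/hasP; exists b; first exact: mem_cube.
  by rewrite Fb bx eqxx.
apply: leq_trans (size_cover cov) _; rewrite big_distrr /= big_seq [leqRHS]big_seq.
apply: leq_sum => P Ps'; rewrite -size_filter -size_cube.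
apply: cut_cover; [exact: ss|exact: proj_seq_filter| |].
  by apply/allP => x; rewrite mem_filter => /andP [/andP []].
by apply/allP => x; rewrite mem_filter => /andP [/andP []].
Qed.

End Counting.

(** * Planar components *)

Section Planar.
Variables (I : eqType) (s : seq I) (e : I -> nat) (V F : I -> pred 'rV[int]_4).
Hypothesis inc : incidence s e V F.

(** A component in exactly one plane: the forms that vanish on it have rank one. *)
Definition planar_component K P := exists b, [/\ b != 0, (supnorm b <= K)%N, F P b
  & forall c, F P c -> parallel b c].

Lemma minimal_form P b : F P b -> b != 0 ->
  exists b', [/\ F P b', b' != 0, (supnorm b' <= supnorm b)%N
    & forall c, F P c -> c != 0 -> (supnorm b' <= supnorm c)%N].
Proof.
move=> Fb b0.
have exP : exists h, `[< exists c, [/\ F P c, c != 0 & supnorm c = h] >].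
  by exists (supnorm b); apply/asboolP; exists b.
case: (ex_minnP exP) => h /asboolP [c [Fc c0 <-]] hmin; exists c; split=> //.
  by apply: hmin; apply/asboolP; exists b.
by move=> c' Fc' c0'; apply: hmin; apply/asboolP; exists c'.
Qed.

(** A shortest form of rank one [F P] is primitive, because [F P] contains the
    quotient by the gcd of the entries; [u] witnesses it. *)
Lemma planar_normal K P : P \in s -> planar_component K P ->
  exists b u, [/\ b != 0, (supnorm b <= K)%N, F P b, dot b u = 1
    & forall c, F P c -> parallel b c /\ (c != 0 -> (supnorm b <= supnorm c)%N)].
Proof.
move=> Ps [b0 [b00 b0K Fb0 Fprop]].
have [b [Fb bn0 bb0 bmin]] := minimal_form Fb0 b00.
have [u [c [bu0 bE]]] := dot_gcd bn0.
have cb : dot b u *: c = 1 *: b by rewrite scale1r -bE.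
have Fc := forms_saturated inc Ps Fb bu0 cb.
have c0 : c != 0 by apply: contraNneq bn0 => c0; rewrite bE c0 scaler0.
have le_bc := bmin _ Fc c0.
have g1 : absz (dot b u) = 1%N.
  have [i ci] := supnorm_attained c0.
  have := le_supnorm b i; rewrite [in X in (X <= _)%N]bE mxE abszM ci => /leq_trans /(_ le_bc).
  have c_gt0 : (0 < supnorm c)%N by rewrite lt0n supnorm_eq0.
  rewrite -[X in (_ <= X)%N]mul1n leq_pmul2r // => g_le1.
  by apply/eqP; rewrite eqn_leq g_le1 lt0n absz_eq0.
exists b, ((dot b u) *: u); split=> //.
- exact: leq_trans bb0 b0K.
- by rewrite dotZr; move: (dot b u) g1 => g; lia.
- move=> c' Fc'; split; last exact: bmin.
  by apply: parallel_trans b00 _ (Fprop _ Fc'); rewrite parallel_sym; exact: Fprop.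
Qed.

(** Siegel's lemma modulo [b]: restricting the entry where [b] attains its norm to
    absolute values below that norm removes the multiples of [b] from the box, so
    that the form found for a point cuts the component properly. The box
    searched has [h (Y + 1)^3] elements, with [h] the norm of [b], against at most
    [8 Y m + 1] values of the product, so [h Y^2 >= 64 m] leaves ample room. *)
Lemma planar_cut_count P b m Y X : P \in s -> b != 0 -> F P b ->
  (forall c, F P c -> parallel b c /\ (c != 0 -> (supnorm b <= supnorm c)%N)) ->
  (64 * m <= supnorm b * Y ^ 2)%N -> (supnorm b <= Y)%N -> (0 < m)%N ->
  proj_seq X -> all (V P) X -> all (fun x => supnorm x <= m)%N X ->
  (size X <= 54 * (supnorm b * Y ^ 3) * e P)%N.
Proof.
move=> Ps b0 Fb Fmin hY hleY m0 pX VX Xm.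
have [i bi] := supnorm_attained b0.
have h0 : (0 < supnorm b)%N by rewrite lt0n supnorm_eq0.
pose k (j : 'I_4) := if j == i then (supnorm b).-1 else Y.
have Y0 : (0 < Y)%N by exact: leq_trans hleY.
have sumk : (\sum_j k j = (supnorm b).-1 + 3 * Y)%N.
  rewrite (bigD1 i) //= {1}/k eqxx (eq_bigr (fun=> Y)) => [|j /negPf ji].
    by rewrite sum_nat_const cardC1 card_ord.
  by rewrite /k ji.
have prodk (g : nat -> nat) : (\prod_j (g (k j)) = g (supnorm b).-1 * g Y ^ 3)%N.
  rewrite (bigD1 i) //= {1}/k eqxx (eq_bigr (fun=> g Y)) => [|j /negPf ji].
    by rewrite prod_nat_const cardC1 card_ord.
  by rewrite /k ji.
have cov : all (fun x => has (fun c => ~~ F P c && (dot c x == 0)) (box k)) X.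
  apply/allP => x xX.
  have [|c c0 [c_in cx]] := @siegel 4 x k m (allP Xm x xX).
    rewrite sumk (prodk succn) prednK //.
    have : ((supnorm b).-1 + 3 * Y <= 4 * Y)%N by move: hleY; clear; lia.
    move: ((supnorm b).-1 + 3 * Y)%N (supnorm b) hY h0 => S h hY h0 SY.
    apply: (@leq_ltn_trans (8 * Y * m + 1)); first by move: SY; clear; nia.
    apply: (@leq_trans (64 * m * Y + h)); first by move: h0 m0 Y0; clear; nia.
    by move: hY; clear; nia.
  apply/hasP; exists c; first exact: mem_box.
  rewrite cx eqxx andbT; apply/negP => Fc.
  have [/parallelP bc /(_ c0) hbc] := Fmin _ Fc.
  have ci_lt : (absz (c 0%R i) < supnorm b)%N.
    by move/forallP: c_in => /(_ i); rewrite /k eqxx -ltnS prednK.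
  have : (supnorm c <= absz (c 0%R i))%N.
    apply/supnorm_leP => j; have /(congr1 absz) := bc i j; rewrite !abszM bi => hc.
    rewrite -(leq_pmul2l h0) hc leq_mul2r; apply/orP; right; exact: le_supnorm.
  by rewrite leqNgt (leq_trans ci_lt hbc).
apply: leq_trans (cut_cover inc Ps pX VX cov) _.
rewrite leq_mul2r; apply/orP; right.
rewrite size_box (prodk (fun z => z.*2.+1)).
move: (supnorm b) h0 => h h0; rewrite -!mul2n.
have -> : (54 * (h * Y ^ 3) = (2 * h) * (3 * Y) ^ 3)%N by clear; ring.
apply: leq_mul; first by move: h0; clear; lia.
by rewrite leq_exp2r //; move: Y0; clear; lia.
Qed.

End Planar.

Lemma leq_sqr a b : (a ^ 2 <= b ^ 2)%N -> (a <= b)%N.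
Proof. by rewrite leq_exp2r. Qed.

(** [Y] is about the square root of [64 m / h]; then [h <= Y] as [h^3 <= 64 m]. *)
Lemma line_height m h : (0 < h)%N -> (h ^ 3 <= 64 * m)%N ->
  exists Y, [/\ (64 * m <= h * Y ^ 2)%N, (h * Y ^ 2 <= 256 * m)%N & (h <= Y)%N].
Proof.
move=> h0 hm; have [r /andP [rl ru]] := @floor_root 2 ((64 * m) %/ h)%N isT.
have h_le : (h <= 64 * m)%N by apply: leq_trans hm; rewrite -{1}[h]expn1 leq_pexp2l.
have q0 : (0 < (64 * m) %/ h)%N by rewrite divn_gt0.
have r0 : (0 < r)%N.
  by rewrite lt0n; apply: contraTneq ru => ->; rewrite exp1n -leqNgt.
have lo : (64 * m <= h * r.+1 ^ 2)%N.
  have := ltn_ceil (64 * m) h0; have := ru; move: (_ %/ _)%N => q; clear -h0; nia.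
exists r.+1; split=> //.
  have := leq_divM (64 * m) h; move: rl r0; move: (_ %/ _)%N => q; clear; nia.
apply: leq_sqr; rewrite -(leq_pmul2l h0); apply: leq_trans lo.
by rewrite -expnS.
Qed.

(** Multiply the square of the claim by [h]: the left side becomes
    [D^2 (h Y^2)^3 <= 2 m h (c m)^3]. *)
Lemma plane_sections_bound c D m h Y : (1 < c)%N -> (0 < h)%N -> (D ^ 2 <= 2 * m * h)%N ->
  (h * Y ^ 2 <= c * m)%N -> (D * (h * Y ^ 3) <= c ^ 2 * m ^ 2)%N.
Proof.
move=> c1 h0 Dm hY; apply: leq_sqr; rewrite -(leq_pmul2r h0).
have -> : ((D * (h * Y ^ 3)) ^ 2 * h = D ^ 2 * (h * Y ^ 2) ^ 3)%N by clear; ring.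
apply: (@leq_trans (2 * m * h * (c * m) ^ 3)%N).
  by apply: leq_mul => //; rewrite leq_exp2r.
have -> : (2 * m * h * (c * m) ^ 3 = 2 * (c ^ 3 * m ^ 4 * h))%N by clear; ring.
have -> : ((c ^ 2 * m ^ 2) ^ 2 * h = c * (c ^ 3 * m ^ 4 * h))%N by clear; ring.
by rewrite leq_mul2r c1 orbT.
Qed.

(** The square of the left side is [H^3 * (H^3 m^2) <= c m * H^3 m^2 = c (m H)^3], and
    [m H < D^2]. *)
Lemma plane_points_bound c D m H h :
  (H <= h)%N -> (h ^ 3 <= c * m)%N -> (2 * m * H < D ^ 2)%N ->
  (H ^ 3 * m <= c * D ^ 3)%N.
Proof.
move=> Hh hm mD; apply: leq_sqr.
have H3 : (H ^ 3 <= c * m)%N by apply: leq_trans hm; rewrite leq_exp2r.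
have D6 : ((2 * m * H) ^ 3 <= (D ^ 2) ^ 3)%N by rewrite leq_exp2r // ltnW.
have -> : ((H ^ 3 * m) ^ 2 = H ^ 3 * (H ^ 3 * m ^ 2))%N by clear; ring.
apply: (@leq_trans (c * m * (H ^ 3 * m ^ 2))); first by rewrite leq_mul2r H3 orbT.
have -> : ((c * D ^ 3) ^ 2 = c ^ 2 * (D ^ 2) ^ 3)%N by clear; ring.
apply: (@leq_trans (c ^ 2 * (2 * m * H) ^ 3)); last by rewrite leq_mul2l D6 orbT.
have -> : (c * m * (H ^ 3 * m ^ 2) = c * (m * H) ^ 3)%N by clear; ring.
apply: leq_mul; first by case: (c) => // c'; rewrite -mulnn leq_pmulr.
by rewrite leq_exp2r // -mulnA leq_pmull.
Qed.

Lemma transverse_bound c D m K : (0 < c)%N -> (K ^ 3 <= c * m)%N -> (D ^ 3 <= m ^ 2)%N ->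
  (D * K ^ 4 <= c ^ 2 * m ^ 2)%N.
Proof.
move=> c0 Km Dm; rewrite -(leq_exp2r _ _ (isT : 0 < 3)%N).
have -> : ((D * K ^ 4) ^ 3 = D ^ 3 * (K ^ 3) ^ 4)%N by clear; ring.
have -> : ((c ^ 2 * m ^ 2) ^ 3 = m ^ 2 * (c * m) ^ 4 * c ^ 2)%N by clear; ring.
apply: leq_trans (leq_pmulr _ _); last by rewrite expn_gt0 c0.
by apply: leq_mul => //; rewrite leq_exp2r.
Qed.

Section PlanarClass.
Variables (I : eqType) (s : seq I) (e : I -> nat) (V F : I -> pred 'rV[int]_4).
Hypothesis inc : incidence s e V F.

Lemma sum_deg_cover (r : pred I) X a c :
  (forall x, x \in X -> exists P, [/\ P \in s, r P & V P x]) ->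
  (forall P, P \in s -> r P -> (a * count (V P) X <= c * e P)%N) ->
  (a * size X <= c * \sum_(P <- s) e P)%N.
Proof.
move=> cov H.
have {}cov : all (fun x => has (fun P => r P && V P x) s) X.
  by apply/allP => x /cov [P [Ps rP Vx]]; apply/hasP; exists P => //; rewrite rP.
apply: leq_trans (leq_mul (leqnn a) (size_cover cov)) _.
rewrite !big_distrr /= big_seq [leqRHS]big_seq; apply: leq_sum => P Ps.
have [rP|_] := boolP (r P); last by rewrite count_pred0 muln0.
exact: H.
Qed.

(** Components in planes of height about [H]. Either each component is cut by the
    further planes of [planar_cut_count], which gives [D^4 h Y^3] points, or the
    points of all [O(H^4)] planes of that height are counted, [m^3 / H] in each.
    The first bound is [O(D^3 m^2)] for [D^2 <= 2 m H], the second one for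
    [D^2 > 2 m H] since [H^3 <= 64 m]. *)
Lemma planar_class_count c D m H X (beta w : I -> 'rV[int]_4) (r : pred I) :
  (256 <= c)%N -> (0 < D)%N -> (0 < m)%N -> (0 < H)%N ->
  (\sum_(P <- s) e P <= 16 * D ^ 4)%N ->
  (forall P, P \in s -> r P -> let b := beta P in
    [/\ b != 0, F P b /\ dot b (w P) = 1, (H <= supnorm b < 2 * H)%N,
        (supnorm b ^ 3 <= 64 * m)%N
     & forall b', F P b' -> parallel b b' /\ (b' != 0 -> (supnorm b <= supnorm b')%N)]) ->
  proj_seq X -> all (fun x => supnorm x <= m)%N X ->
  (forall x, x \in X -> exists P, [/\ P \in s, r P & V P x]) ->
  (size X <= 54 * c ^ 2 * 16 * (D ^ 3 * m ^ 2) + 5 ^ 4 * 131 ^ 3 * c * (D ^ 3 * m ^ 2))%N.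
Proof.
move=> c256 D0 m0 H0 dD betaP pX Xm cov.
have c1 : (1 < c)%N by apply: leq_trans c256.
have [Dm|mD] := leqP (D ^ 2) (2 * m * H).
  apply: leq_trans (leq_addr _ _); rewrite -(leq_pmul2l D0).
  apply: (@leq_trans (54 * (c ^ 2 * m ^ 2) * (16 * D ^ 4))); last first.
    by apply: eq_leq; clear; ring.
  apply: leq_trans (leq_mul (leqnn _) dD); apply: (sum_deg_cover cov) => P Ps rP.
  have [b0 [Fb bw] /andP [Hh hH] h3 bmin] := betaP P Ps rP.
  move: (beta P) b0 Fb bw Hh hH h3 bmin => b b0 Fb bw Hh hH h3 bmin.
  have h0 : (0 < supnorm b)%N by rewrite lt0n supnorm_eq0.
  have [Y [Y1 Y2 Y3]] := line_height h0 h3.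
  have Y2' : (supnorm b * Y ^ 2 <= c * m)%N.
    by apply: leq_trans Y2 _; rewrite leq_mul2r c256 orbT.
  have Dm' : (D ^ 2 <= 2 * m * supnorm b)%N.
    by apply: leq_trans Dm _; rewrite leq_mul2l Hh orbT.
  have AB := plane_sections_bound c1 h0 Dm' Y2'.
  rewrite -size_filter.
  have Xm' : all (fun x => supnorm x <= m)%N (filter (V P) X).
    by apply/allP => x; rewrite mem_filter => /andP [_ /(allP Xm)].
  have := planar_cut_count inc Ps b0 Fb bmin Y1 Y3 m0 (proj_seq_filter (V P) pX)
    (filter_all _ _) Xm'.
  move=> /(leq_mul (leqnn D)) /leq_trans; apply.
  by rewrite mulnA leq_mul2r mulnCA leq_mul2l AB !orbT.
have [P0|noP] := boolP (has r s); last first.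
  case: X {pX Xm} cov noP => [|x X] cov; first by [].
  by have [P [Ps rP _]] := cov x (mem_head _ _); case/hasP; exists P.
apply: leq_trans (leq_addl _ _); rewrite -(leq_pmul2l H0).
pose J := cube (2 * H).
pose q b x := has (fun P => [&& r P, V P x & beta P == b]) s.
have cov' : all (fun x => has (q^~ x) J) X.
  apply/allP => x /cov [P [Ps rP Vx]]; have [_ _ /andP [_ hH] _ _] := betaP P Ps rP.
  apply/hasP; exists (beta P); first by apply: mem_cube; exact: ltnW.
  by apply/hasP; exists P => //; rewrite rP Vx eqxx.
have cnt b : (H * count (q b) X <= (131 * m) ^ 3)%N.
  have [/hasP [P Ps /andP [rP /eqP bP]]|no] :=
    boolP (has (fun P => r P && (beta P == b)) s); last first.
    rewrite (eq_count (a2 := pred0)) ?count_pred0 ?muln0 // => x /=.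
    apply: contraNF no => /hasP [P Ps /and3P [rP _ bP]].
    by apply/hasP; exists P => //; rewrite rP.
  have [b0 [Fb bw] /andP [Hh hH] h3 _] := betaP P Ps rP.
  rewrite bP in b0 Fb bw Hh hH h3.
  have [i bi] := supnorm_attained b0.
  have h0 : (0 < supnorm b)%N by rewrite lt0n supnorm_eq0.
  have := @hyperplane_count 4 b (w P) i m (supnorm b) (filter (q b) X) bw bi h0.
  rewrite filter_uniq ?proj_seq_uniq // => /(_ isT); rewrite size_filter => hc.
  apply: (@leq_trans ((2 * (m + supnorm b)).+1 ^ 3)%N); last first.
    rewrite leq_exp2r //.
    have : (supnorm b <= 64 * m)%N.
      by apply: leq_trans h3; rewrite -{1}[supnorm b]expn1 leq_pexp2l.
    by move: m0; clear; lia.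
  apply: leq_trans (hc _); first by rewrite mulnC leq_mul2l Hh orbT.
  move=> x; rewrite mem_filter => /andP [/hasP [Q Qs /and3P [rQ VQ /eqP bQ]] xX].
  have [_ [FQ _] _ _ _] := betaP Q Qs rQ; rewrite bQ in FQ.
  by split; [exact: forms_vanish inc _ _ _ Qs FQ VQ | exact: (allP Xm)].
apply: leq_trans (leq_mul (leqnn H) (size_cover cov')) _.
rewrite big_distrr /=.
apply: (@leq_trans (\sum_(b <- J) (131 * m) ^ 3)); first by apply: leq_sum.
rewrite big_const_seq count_predT iter_addn_0 size_cube.
have /hasP [P Ps rP] := P0; have [_ _ /andP [Hh _] h3 _] := betaP P Ps rP.
have h3' : (supnorm (beta P) ^ 3 <= c * m)%N.
  by apply: leq_trans h3 _; rewrite leq_mul2r (leq_trans _ c256) ?orbT.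
have AB := plane_points_bound Hh h3' mD.
rewrite mulnC; apply: (@leq_trans ((5 * H) ^ 4 * (131 * m) ^ 3)).
  by rewrite leq_mul2r leq_exp2r //; apply/orP; right; move: H0; clear; lia.
rewrite !expnMn; move: (5 ^ 4)%N (131 ^ 3)%N => k l.
have -> : (k * H ^ 4 * (l * m ^ 3) = H * (k * l) * m ^ 2 * (H ^ 3 * m))%N.
  by clear; ring.
apply: (@leq_trans (H * (k * l) * m ^ 2 * (c * D ^ 3))); first by rewrite leq_mul2l AB orbT.
by apply: eq_leq; clear; ring.
Qed.
End PlanarClass.

Section PlanarCount.
Variables (I : eqType) (s : seq I) (e : I -> nat) (V F : I -> pred 'rV[int]_4).
Hypothesis inc : incidence s e V F.

(** There are [O(log m)] dyadic classes of heights. *)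
Lemma planar_count c D m K X :
  (256 <= c)%N -> (0 < D)%N -> (0 < m)%N ->
  (\sum_(P <- s) e P <= 16 * D ^ 4)%N -> (K ^ 3 <= 64 * m)%N ->
  proj_seq X -> all (fun x => supnorm x <= m)%N X ->
  (forall x, x \in X -> exists P, [/\ P \in s, planar_component F K P & V P x]) ->
  (size X <= (trunc_log 2 m + 3) *
    (54 * c ^ 2 * 16 * (D ^ 3 * m ^ 2) + 5 ^ 4 * 131 ^ 3 * c * (D ^ 3 * m ^ 2)))%N.
Proof.
move=> c256 D0 m0 dD Km pX Xm cov; set bnd := (54 * _ * _ * _ + _)%N.
have /choice [bw bwP] : forall P, exists bw : 'rV[int]_4 * 'rV[int]_4,
    P \in s -> planar_component F K P -> [/\ bw.1 != 0, F P bw.1 /\ dot bw.1 bw.2 = 1,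
      (supnorm bw.1 ^ 3 <= 64 * m)%N
     & forall b', F P b' -> parallel bw.1 b' /\ (b' != 0 -> (supnorm bw.1 <= supnorm b')%N)].
  move=> P; have [[Ps plP]|nP] := pselect (P \in s /\ planar_component F K P); last first.
    by exists (0, 0) => Ps plP; case: nP.
  have [b [u [b0 bK Fb bu bmin]]] := planar_normal inc Ps plP.
  by exists (b, u) => _ _; split=> //; apply: leq_trans Km; rewrite leq_exp2r.
pose lev P := trunc_log 2 (supnorm (bw P).1).
pose cls i P := `[< planar_component F K P >] && (lev P == i).
pose q i x := has (fun P => cls i P && V P x) s.
have lev_lt P : P \in s -> planar_component F K P -> (lev P < trunc_log 2 m + 3)%N.
  move=> Ps plP; have [b0 _ h3 _] := bwP P Ps plP.
  have lo : (2 ^ lev P <= supnorm (bw P).1)%N.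
    by apply: trunc_logP; rewrite // lt0n supnorm_eq0.
  have hi := @trunc_log_ltn 2 m isT.
  rewrite -(ltn_exp2l _ _ (isT : 1 < 2)%N); move: lo h3 hi.
  rewrite addn3 !expnS expn0; move: (2 ^ lev P)%N (2 ^ trunc_log 2 m)%N (supnorm _) m0.
  rewrite /= => x y z m0 xz z3 my; rewrite ltnNge; apply/negP => yx.
  have : (64 * m < z * z * z)%N by move: m0 my xz yx; clear; nia.
  by move: z3; clear; lia.
have cov' : all (fun x => has (q^~ x) (iota 0 (trunc_log 2 m + 3))) X.
  apply/allP => x /cov [P [Ps plP VP]]; apply/hasP; exists (lev P).
    by rewrite mem_iota add0n lev_lt.
  by apply/hasP; exists P => //; rewrite /cls eqxx VP !andbT; apply/asboolP.
apply: leq_trans (size_cover cov') _.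
rewrite -[X in (_ <= X * _)%N](size_iota 0) -sum1_size big_distrl /=.
apply: leq_sum => i _; rewrite mul1n -size_filter.
apply: (@planar_class_count _ _ _ _ _ inc c D m (2 ^ i) (filter (q i) X)
  (fun P => (bw P).1) (fun P => (bw P).2) (cls i)) => //.
- by rewrite expn_gt0.
- move=> P Ps /andP [/asboolP plP /eqP levP] /=.
  have [b0 Fb h3 bmin] := bwP P Ps plP; split=> //.
  by rewrite -levP -expnS; apply: trunc_log_bounds; rewrite // lt0n supnorm_eq0.
- exact: proj_seq_filter.
- by apply/allP => x; rewrite mem_filter => /andP [_ /(allP Xm)].
- move=> x; rewrite mem_filter => /andP [/hasP [P Ps /andP [clsP VP]] _].
  by exists P.
Qed.
End PlanarCount.

(** * Linear components *)

Section LinearComponents.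
Variables (I : eqType) (s : seq I) (e : I -> nat) (V F : I -> pred 'rV[int]_4).
Hypothesis inc : incidence s e V F.

(** A component in two distinct planes, hence in their line. *)
Definition linear_component P := exists b c, [/\ F P b, F P c & ~~ parallel b c].

Lemma successive_minima_exist b c x y m : ~~ parallel b c -> (dot b x = 0 /\ dot c x = 0) ->
  (dot b y = 0 /\ dot c y = 0) -> ~~ parallel x y ->
  (supnorm x <= m)%N -> (supnorm y <= m)%N ->
  exists v1 v2, successive_minima b c v1 v2 /\ (supnorm v2 <= m)%N.
Proof.
move=> bc Wx Wy xy xm ym; pose W x := dot b x = 0 /\ dot c x = 0.
have min_ex (Q : 'rV[int]_4 -> Prop) z : Q z ->
    exists2 v, Q v & forall y, Q y -> (supnorm v <= supnorm y)%N.
  move=> Qz; have exh : exists h, `[< exists2 v, Q v & supnorm v = h >].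
    by exists (supnorm z); apply/asboolP; exists z.
  case: (ex_minnP exh) => h /asboolP [v Qv <-] vmin; exists v => // v' Qv'.
  by apply: vmin; apply/asboolP; exists v'.
have x0 : x != 0 by apply: contraNneq xy => ->; exact: parallel0.
have [v1 [Wv1 v10] min1] := min_ex (fun v => W v /\ v != 0) x (conj Wx x0).
have [z [Wz v1z zm]] : exists z, [/\ W z, ~~ parallel v1 z & (supnorm z <= m)%N].
  have [v1x|v1x] := boolP (parallel v1 x); last by exists x.
  exists y; split=> //; apply: contra xy; apply: parallel_trans v10 _.
  by rewrite parallel_sym.
have [v2 [Wv2 v12] min2] := min_ex (fun v => W v /\ ~~ parallel v1 v) z (conj Wz v1z).
exists v1, v2; split; last by apply: leq_trans zm; apply: min2.
by split=> // y' Wy' Py'; [apply: min1|apply: min2].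
Qed.

Lemma proj_seq_pair X : proj_seq X -> (1 < size X)%N ->
  exists x y : 'rV[int]_4, [/\ x \in X, y \in X & ~~ parallel x y].
Proof.
case: X => [|x [|y X]] // /andP [_] /= /andP [/andP [xy _] _] _.
by exists x, y; rewrite !inE !eqxx orbT.
Qed.

Lemma dot_span (d u v x : 'rV[int]_4) (p q : rat) :
  (forall i, (x 0 i)%:~R = p * (u 0 i)%:~R + q * (v 0 i)%:~R) ->
  dot d u = 0 -> dot d v = 0 -> dot d x = 0.
Proof.
move=> xE du dv; apply/eqP; rewrite -(eqr_int rat).
have dotR z : (dot d z)%:~R = \sum_i (d 0 i)%:~R * (z 0 i)%:~R :> rat.
  by rewrite rmorph_sum; apply: eq_bigr => i _; rewrite rmorphM.
have -> : (dot d x)%:~R = p * (dot d u)%:~R + q * (dot d v)%:~R :> rat.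
  rewrite !dotR !mulr_sumr -big_split; apply: eq_bigr => i _ /=.
  by rewrite xE mulrDr !(mulrCA (d 0 i)%:~R).
by rewrite du dv !mulr0 addr0.
Qed.

(** Lines whose minima are about [2^i] and [2^j], with product [T]. Each has
    [O(m^2 / T)] points; there are at most [d], that is [O(D^4)], lines, and at most
    [O(T^4)] as each is spanned by its two minimal vectors. The first number serves
    for [D <= T], the second one for [T < D]. *)
Lemma line_class_count D m i j X (b c v1 v2 : I -> 'rV[int]_4) (r : pred I) :
  (0 < D)%N -> (\sum_(P <- s) e P <= 16 * D ^ 4)%N ->
  (forall P, P \in s -> r P -> [/\ F P (b P), F P (c P),
    successive_minima (b P) (c P) (v1 P) (v2 P) /\ (supnorm (v2 P) <= m)%N,
    (2 ^ i <= supnorm (v1 P) < 2 ^ i.+1)%N & (2 ^ j <= supnorm (v2 P) < 2 ^ j.+1)%N]) ->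
  proj_seq X -> all (fun x => supnorm x <= m)%N X ->
  (forall x, x \in X -> exists P, [/\ P \in s, r P & V P x]) ->
  (size X <= 165 * 16 * (D ^ 3 * m ^ 2) + 5 ^ 8 * 165 * (D ^ 3 * m ^ 2))%N.
Proof.
move=> D0 dD Hr pX Xm cov; set T := (2 ^ i * 2 ^ j)%N.
have T0 : (0 < T)%N by rewrite muln_gt0 !expn_gt0.
have cnt (q : pred 'rV[int]_4) P : P \in s -> r P ->
    (forall x, x \in X -> q x ->
      exists Q, [/\ Q \in s, r Q, V Q x, v1 Q = v1 P & v2 Q = v2 P]) ->
    (T * count q X <= 165 * m ^ 2)%N.
  move=> Ps rP qP; have [Fb Fc [minP v2m] /andP [li _] /andP [lj _]] := Hr P Ps rP.
  have [_ [[b1 c1] [b2 c2]] v12 _ _] := minP.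
  apply: (@leq_trans (count q X * (supnorm (v1 P) * supnorm (v2 P)))).
    by rewrite mulnC leq_mul2l leq_mul ?orbT.
  rewrite -size_filter; apply: (line_count minP v2m).
    by rewrite filter_uniq // proj_seq_uniq.
  move=> x; rewrite mem_filter => /andP [qx xX]; split; last exact: (allP Xm).
  have [Q [Qs rQ VQ e1 e2]] := qP x xX qx.
  have [FbQ FcQ [[bcQ [W1Q W2Q] _ _ _] _] _ _] := Hr Q Qs rQ.
  (* P and Q may come with different pairs of forms, but v1 and v2 span both lines. *)
  have [|p' [q' xE]] := @line_span (b Q) (c Q) (v1 P) (v2 P) x bcQ v12.
    move=> y; rewrite !inE => /or3P [] /eqP ->; rewrite -?e1 -?e2 //.
    by rewrite !(forms_vanish inc Qs _ VQ).
  by split; apply: (dot_span xE).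
have [DT|TD] := leqP D T.
  apply: leq_trans (leq_addr _ _); rewrite -(leq_pmul2l D0).
  apply: (@leq_trans (T * size X)); first by rewrite leq_mul2r DT orbT.
  apply: (@leq_trans (165 * m ^ 2 * (16 * D ^ 4))); last by apply: eq_leq; clear; ring.
  apply: leq_trans (leq_mul (leqnn _) dD); apply: (sum_deg_cover cov) => P Ps rP.
  apply: leq_trans (leq_pmulr _ (deg_gt0 inc Ps)).
  by apply: (cnt (V P) P Ps rP) => x _ Vx; exists P.
apply: leq_trans (leq_addl _ _); rewrite -(leq_pmul2l T0).
pose J := [seq (u, v) | u <- cube (2 ^ i.+1), v <- cube (2 ^ j.+1)].
pose q (uv : 'rV[int]_4 * 'rV[int]_4) x :=
  has (fun P => [&& r P, V P x, v1 P == uv.1 & v2 P == uv.2]) s.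
have cov' : all (fun x => has (q^~ x) J) X.
  apply/allP => x /cov [P [Ps rP VP]].
  have [_ _ _ /andP [_ /ltnW l1] /andP [_ /ltnW l2]] := Hr P Ps rP.
  apply/hasP; exists (v1 P, v2 P).
    by apply: allpairs_f; apply: mem_cube.
  by apply/hasP; exists P => //; rewrite rP VP !eqxx.
apply: leq_trans (leq_mul (leqnn T) (size_cover cov')) _.
rewrite big_distrr /=; apply: (@leq_trans (\sum_(uv <- J) 165 * m ^ 2)).
  apply: leq_sum => uv _.
  have [/hasP [P Ps /and3P [rP /eqP e1 /eqP e2]]|no] :=
    boolP (has (fun P => [&& r P, v1 P == uv.1 & v2 P == uv.2]) s).
    apply: (cnt (q uv) P Ps rP) => x _ /hasP [Q Qs /and4P [rQ VQ /eqP e1' /eqP e2']].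
    by exists Q; split=> //; rewrite ?e1' ?e2' ?e1 ?e2.
  rewrite (eq_count (a2 := pred0)) ?count_pred0 ?muln0 // => x /=.
  apply: contraNF no => /hasP [P Ps /and4P [rP _ e1 e2]].
  by apply/hasP; exists P => //; rewrite rP e1.
rewrite big_const_seq count_predT iter_addn_0 size_allpairs !size_cube.
apply: (@leq_trans (165 * m ^ 2 * ((5 * 2 ^ i) ^ 4 * (5 * 2 ^ j) ^ 4))).
  have le5 k : ((2 ^ k.+1).*2.+1 <= 5 * 2 ^ k)%N.
    by rewrite expnS; have := expn_gt0 2 k; move: (2 ^ k)%N => z; clear; lia.
  by rewrite leq_mul2l leq_mul ?orbT // leq_exp2r.
rewrite !expnMn (expnD 5 4 4 : 5 ^ 8 = _)%N; move: (5 ^ 4)%N => k4.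
have -> : (165 * m ^ 2 * (k4 * (2 ^ i) ^ 4 * (k4 * (2 ^ j) ^ 4)) =
    k4 * k4 * 165 * m ^ 2 * (T * T ^ 3))%N by rewrite /T; clear; ring.
have -> : (T * (k4 * k4 * 165 * (D ^ 3 * m ^ 2)) = k4 * k4 * 165 * m ^ 2 * (T * D ^ 3))%N.
  by clear; ring.
by rewrite leq_mul2l leq_mul ?orbT // leq_exp2r // ltnW.
Qed.

(** Components with at most one point of [X] contribute at most [d]; the others
    contain a basis of their line, so both minima are at most [m] and there are
    [O((log m)^2)] classes. *)
Lemma linear_count D m X :
  (0 < D)%N -> (0 < m)%N -> (D ^ 3 <= m ^ 2)%N -> (\sum_(P <- s) e P <= 16 * D ^ 4)%N ->
  proj_seq X -> all (fun x => supnorm x <= m)%N X ->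
  (forall x, x \in X -> exists P, [/\ P \in s, linear_component P & V P x]) ->
  (size X <= 16 * (D ^ 3 * m ^ 2) + ((trunc_log 2 m).+1 ^ 2) *
    (165 * 16 * (D ^ 3 * m ^ 2) + 5 ^ 8 * 165 * (D ^ 3 * m ^ 2)))%N.
Proof.
move=> D0 m0 Dm dD pX Xm cov; set bnd := (165 * _ * _ + _)%N.
pose few P := (count (V P) X <= 1)%N.
rewrite -(count_predC (fun x => has (fun P => few P && V P x) s) X).
apply: leq_add; rewrite -size_filter; set Y := filter _ X.
  have covY : forall x, x \in Y -> exists P, [/\ P \in s, few P & V P x].
    by move=> x; rewrite mem_filter => /andP [/hasP [P Ps /andP [? ?]] _]; exists P.
  have H : (size Y <= \sum_(P <- s) e P)%N.
    rewrite -[leqLHS]mul1n -[leqRHS]mul1n; apply: (sum_deg_cover covY) => P Ps fewP.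
    rewrite !mul1n; apply: leq_trans (deg_gt0 inc Ps).
    by apply: leq_trans fewP; rewrite count_filter; apply: sub_count => x /andP [].
  apply: leq_trans H _.
  apply: leq_trans dD _; rewrite leq_mul2l /= expnSr leq_mul2l; apply/orP; right.
  by apply: leq_trans Dm; rewrite -{1}[D]expn1 leq_pexp2l.
have /choice [v vP] : forall P,
    exists v : ('rV[int]_4 * 'rV[int]_4) * ('rV[int]_4 * 'rV[int]_4),
    P \in s -> linear_component P -> ~~ few P ->
    [/\ F P v.1.1, F P v.1.2, successive_minima v.1.1 v.1.2 v.2.1 v.2.2
      & (supnorm v.2.2 <= m)%N].
  move=> P; have [[Ps lP nP]|nP] :=
    pselect [/\ P \in s, linear_component P & ~~ few P]; last first.
    by exists ((0, 0), (0, 0)) => *; case: nP.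
  have [b [c [Fb Fc bc]]] := lP.
  have [||x [y [xX yX xy]]] := @proj_seq_pair (filter (V P) X).
  - exact: proj_seq_filter.
  - by rewrite size_filter ltnNge.
  have [v1 [v2 [Hmin v2m]]] : exists v1 v2, successive_minima b c v1 v2 /\ (supnorm v2 <= m)%N.
    move: xX yX; rewrite !mem_filter => /andP [Vx xX] /andP [Vy yX].
    apply: (successive_minima_exist bc _ _ xy (allP Xm x xX) (allP Xm y yX)).
      by rewrite (forms_vanish inc Ps Fb Vx) (forms_vanish inc Ps Fc Vx).
    by rewrite (forms_vanish inc Ps Fb Vy) (forms_vanish inc Ps Fc Vy).
  by exists ((b, c), (v1, v2)).
set L := (trunc_log 2 m).+1.
pose lev P := (trunc_log 2 (supnorm (v P).2.1), trunc_log 2 (supnorm (v P).2.2)).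
pose cls ij P := [&& `[< linear_component P >], ~~ few P & lev P == ij].
pose q ij x := has (fun P => cls ij P && V P x) s.
pose J := [seq (i, j) | i <- iota 0 L, j <- iota 0 L].
have facts P : P \in s -> linear_component P -> ~~ few P ->
    [/\ (0 < supnorm (v P).2.1)%N, (0 < supnorm (v P).2.2)%N
      & (supnorm (v P).2.1 <= supnorm (v P).2.2)%N].
  move=> Ps lP fP; have [_ _ [_ [_ W2] v12 min1 _] _] := vP P Ps lP fP.
  have v10 : (v P).2.1 != 0 by apply: contraNneq v12 => ->; exact: parallel0.
  have v20 : (v P).2.2 != 0 by apply: contraNneq v12 => ->; rewrite parallel_sym parallel0.
  by rewrite !lt0n !supnorm_eq0 v10 v20; split=> //; apply: min1.
have cov' : all (fun x => has (q^~ x) J) Y.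
  apply/allP => x; rewrite mem_filter => /andP [/hasPn nf /cov [P [Ps lP VP]]].
  have fP : ~~ few P by have := nf P Ps; rewrite VP andbT.
  have [h1 h2 h12] := facts P Ps lP fP; have [_ _ _ h2m] := vP P Ps lP fP.
  apply/hasP; exists (lev P); last first.
    by apply/hasP; exists P => //; rewrite /cls fP eqxx VP !andbT; apply/asboolP.
  by apply: allpairs_f; rewrite mem_iota add0n /= ltnS; apply: leq_trunc_log => //;
    exact: leq_trans h12 _.
apply: leq_trans (size_cover cov') _.
have -> : (L ^ 2 = size J)%N by rewrite size_allpairs !size_iota mulnn.
rewrite -sum1_size big_distrl /=; apply: leq_sum => -[i j] _.
rewrite mul1n -size_filter.
apply: (@line_class_count D m i j _ (fun P => (v P).1.1) (fun P => (v P).1.2)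
  (fun P => (v P).2.1) (fun P => (v P).2.2) (cls (i, j))) => //.
- move=> P Ps /and3P [/asboolP lP fP /eqP [<- <-]].
  have [h1 h2 h12] := facts P Ps lP fP; have [Fb Fc mi h2m] := vP P Ps lP fP.
  by split=> //; apply: trunc_log_bounds.
- exact/proj_seq_filter/proj_seq_filter.
- by apply/allP => x; rewrite !mem_filter => /and3P [_ _ /(allP Xm)].
- move=> x; rewrite mem_filter => /andP [/hasP [P Ps /andP [clsP VP]] _].
  by exists P.
Qed.
End LinearComponents.

(** * The counting theorem *)

(** A point of a component [P] lies on a plane of height at most [K], about
    [(8 m)^(1/3)]. If it does not contain [P], it is one of [O(K^4)] planes that cut
    the components properly; otherwise [P] is planar or linear. *)
Lemma curve_count : exists C : nat, forall (I : eqType) (s : seq I) (e : I -> nat)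
    (V F : I -> pred 'rV[int]_4) (D m : nat) (X : seq 'rV[int]_4),
  incidence s e V F -> (0 < D)%N -> (1 < m)%N -> (\sum_(P <- s) e P <= 16 * D ^ 4)%N ->
  proj_seq X -> all (fun x => supnorm x <= m)%N X ->
  (forall x, x \in X -> exists2 P, P \in s & V P x) ->
  (size X <= C * (D ^ 3 * m ^ 2 * trunc_log 2 m ^ 2))%N.
Proof.
have name (n : nat) : exists k, k = n by exists n.
have [cB cBE] := name (54 * 256 ^ 2 * 16 + 5 ^ 4 * 131 ^ 3 * 256)%N.
have [cC cCE] := name (165 * 16 + 5 ^ 8 * 165)%N.
have [cA cAE] := name (3 ^ 4 * 64 ^ 2 * 16)%N.
have [c0 c0E] := name (3 ^ 4)%N.
exists (c0 + (cA + 4 * cB + (16 + 4 * cC)))%N.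
move=> I s e V F D m X inc D0 m1 dD pX Xm cov.
have m0 : (0 < m)%N by exact: ltnW.
set L := trunc_log 2 m; have L0 : (0 < L)%N by rewrite trunc_log_gt0.
set N := (D ^ 3 * m ^ 2)%N.
have NL : (N <= N * L ^ 2)%N by rewrite leq_pmulr // expn_gt0 L0.
have [mD|Dm] := leqP (m ^ 2) (D ^ 3).
  rewrite mulnDl; apply: leq_trans (leq_addr _ _).
  apply: (@leq_trans (c0 * N)); last by rewrite leq_mul2l NL orbT.
  have := size_in_box (k := fun=> m) (proj_seq_uniq pX).
  have -> : all (in_box (fun=> m)) X.
    by apply/allP => x /(allP Xm) /supnorm_leP xm; apply/forallP.
  move=> /(_ isT) /leq_trans; apply; rewrite prod_nat_const card_ord.
  apply: (@leq_trans ((3 * m) ^ 4)); first by rewrite leq_exp2r //; move: m0; clear; lia.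
  by rewrite c0E expnMn leq_mul2l /= /N (expnD m 2 2 : m ^ 4 = _)%N leq_mul2r mD orbT.
have [r /andP [rl ru]] := @floor_root 3 (8 * m) isT.
have r0 : (0 < r)%N.
  by rewrite lt0n; apply: contraTneq ru => ->; rewrite -leqNgt muln_gt0.
set K := r.+1 in ru.
have K3 : (K ^ 3 <= 64 * m)%N.
  apply: (@leq_trans ((2 * r) ^ 3)); first by rewrite leq_exp2r // /K; move: r0; clear; lia.
  by rewrite expnMn -[64%N]/(8 * 8)%N -mulnA leq_mul2l rl orbT.
pose A P x := exists b, [/\ (supnorm b <= K)%N, ~~ F P b & dot b x = 0].
pose XA := [seq x <- X | `[< exists P, [/\ P \in s, V P x & A P x] >]].
pose XB := [seq x <- X | `[< exists P, [/\ P \in s, planar_component F K P & V P x] >]].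
pose XC := [seq x <- X | `[< exists P, [/\ P \in s, linear_component F P & V P x] >]].
have split3 : (size X <= size XA + size XB + size XC)%N.
  rewrite !size_filter -addnA.
  pose qs := [:: (fun x => `[< exists P, [/\ P \in s, V P x & A P x] >]);
    (fun x => `[< exists P, [/\ P \in s, planar_component F K P & V P x] >]);
    (fun x => `[< exists P, [/\ P \in s, linear_component F P & V P x] >])].
  have := @size_cover _ _ X qs (fun q => q); rewrite /= !big_cons big_nil addn0; apply.
  apply/allP => x xX; have [P Ps VP] := cov x xX.
  have [||b b0 [/forallP bK bx]] := @siegel 4 x (fun=> K) m.
  - exact: (allP Xm).
  - rewrite sum_nat_const prod_nat_const card_ord.
    have K0 : (0 < K)%N by [].
    clearbody K; apply: (@leq_ltn_trans (K * K ^ 3)); last by rewrite -expnS ltn_exp2r.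
    have -> : (2 * (4 * K) * m = K * (8 * m))%N by clear; ring.
    apply: (@leq_trans (K * (8 * m).+1)); last by rewrite leq_mul2l ru orbT.
    by rewrite mulnS addnC leq_add2r.
  have {}bK : (supnorm b <= K)%N by apply/supnorm_leP.
  rewrite /qs /=; have [Fb|Fb] := boolP (F P b); last first.
    apply/orP; left; apply/asboolP; exists P; split=> //; by exists b.
  have [[b1 [c [Fb1 Fc b1c]]]|nl] := pselect (linear_component F P).
    by apply/or4P/Or43/asboolP; exists P; split=> //; exists b1, c.
  apply/or4P/Or42/asboolP; exists P; split=> //; exists b; split=> // c Fc.
  by apply: contrapT => /negP bc; apply: nl; exists b, c.
have hA : (size XA <= cA * N)%N.
  rewrite cAE.
  apply: (@leq_trans (K.*2.+1 ^ 4 * \sum_(P <- s) e P)).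
    apply: (transverse_count inc (s' := s)) => //; first exact: proj_seq_filter.
    by move=> x; rewrite mem_filter => /andP [/asboolP].
  apply: (@leq_trans ((3 * K) ^ 4 * (16 * D ^ 4))).
    by apply: leq_mul => //; rewrite leq_exp2r // /K; clear; lia.
  have AA := @transverse_bound 64 D m K isT K3 (ltnW Dm).
  rewrite expnMn (expnS D 3) /N; move: (3 ^ 4)%N (64 ^ 2)%N AA => k l AA.
  have -> : (k * K ^ 4 * (16 * (D * D ^ 3)) = k * 16 * D ^ 3 * (D * K ^ 4))%N by clear; ring.
  have -> : (k * l * 16 * (D ^ 3 * m ^ 2) = k * 16 * D ^ 3 * (l * m ^ 2))%N by clear; ring.
  by rewrite leq_mul2l AA orbT.
have mulcN k : (4 * k * (N * L ^ 2) = 4 * L ^ 2 * (k * N))%N.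
  by rewrite -[LHS]mulnA -[RHS]mulnA [(k * (N * _))%N]mulnA [(k * N * _)%N]mulnC.
have hB : (size XB <= 4 * cB * (N * L ^ 2))%N.
  apply: (@leq_trans ((L + 3) * (cB * N))).
    rewrite cBE [((_ + _) * N)%N]mulnDl; apply: (planar_count inc (K := K)) => //.
      exact: proj_seq_filter.
      by apply/allP => x; rewrite mem_filter => /andP [_ /(allP Xm)].
    by move=> x; rewrite mem_filter => /andP [/asboolP].
  have : (L + 3 <= 4 * L ^ 2)%N by move: L0; clear; nia.
  have -> : (4 * cB * (N * L ^ 2) = 4 * L ^ 2 * (cB * N))%N by exact: mulcN.
  by move=> l2; rewrite leq_mul2r l2 orbT.
have hC : (size XC <= (16 + 4 * cC) * (N * L ^ 2))%N.
  apply: (@leq_trans (16 * N + L.+1 ^ 2 * (cC * N))).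
    rewrite cCE [((_ + _) * N)%N]mulnDl; apply: (linear_count inc) => //.
    - exact: ltnW.
    - exact: proj_seq_filter.
    - by apply/allP => x; rewrite mem_filter => /andP [_ /(allP Xm)].
    - by move=> x; rewrite mem_filter => /andP [/asboolP].
  have l2 : (L.+1 ^ 2 <= 4 * L ^ 2)%N by move: L0; clear; nia.
  rewrite mulnDl; apply: leq_add; first by rewrite leq_mul2l NL orbT.
  have -> : (4 * cC * (N * L ^ 2) = 4 * L ^ 2 * (cC * N))%N by exact: mulcN.
  by rewrite leq_mul2r l2 orbT.
apply: leq_trans split3 _; rewrite mulnDl; apply: leq_trans (leq_addl _ _).
have hA' := leq_trans hA (leq_mul (leqnn _) NL).
rewrite (mulnDl (cA + _)) (mulnDl cA).
exact: leq_add (leq_add hA' hB) hC.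
Qed.

(** * Hilbert functions of homogeneous ideals *)

Section HilbertFunction.
Variables (k : fieldType) (n : nat).
Local Notation S := {mpoly k[n.+1]}.
Implicit Types (I J P Q : set S) (f g h : S) (t d : nat).

Definition homog_ideal I := is_ideal I /\ homogeneous I.
Definition add_gen I f : set S := [set h | exists a, exists2 g, I g & h = a * f + g]%classic.
Definition colon I f : set S := [set g | I (g * f)]%classic.

Lemma ideal0 I : homog_ideal I -> I 0. Proof. by case=> [[]]. Qed.
Lemma idealD I f g : homog_ideal I -> I f -> I g -> I (f + g).
Proof. by case=> [[_ ID] _] If Ig; rewrite -[f]mul1r; apply: ID. Qed.
Lemma idealM I a f : homog_ideal I -> I f -> I (a * f).
Proof. by case=> [[I0 ID] _] If; rewrite -[_ * _]addr0; apply: ID. Qed.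
Lemma idealB I f g : homog_ideal I -> I f -> I g -> I (f - g).
Proof. by move=> hI If Ig; apply: idealD => //; rewrite -mulN1r; exact: idealM. Qed.
Lemma ideal_sum I (T : Type) (r : seq T) (P : pred T) (F : T -> S) : homog_ideal I ->
  (forall x, P x -> I (F x)) -> I (\sum_(x <- r | P x) F x).
Proof. by move=> hI H; elim/big_ind: _ => //; [exact: ideal0|move=> *; exact: idealD]. Qed.

Lemma pihomog_sum f : exists N, forall M, (N <= M)%N -> f = \sum_(d < M) pihomog mdeg d f.
Proof. by exists (msize f) => M; exact: pihomog_partitionE. Qed.

Lemma pihomogM f d g t : f \is d.-homog ->
  pihomog mdeg (t + d)%N (g * f) = pihomog mdeg t g * f.
Proof.
move=> fd; have [N /(_ (maxn N t.+1) (leq_maxl _ _)) {1}->] := pihomog_sum g.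
rewrite big_distrl /= raddf_sum /= (bigD1 (Ordinal (leq_maxr N t.+1))) //= big1 ?addr0.
  by rewrite pihomog_dE //; apply: dhomogM => //; exact: pihomogP.
move=> [i iN] /= it; apply: (@pihomog_ne0 _ _ _ (i + d)%N); last first.
  by apply: dhomogM => //; exact: pihomogP.
by rewrite eqn_add2r; apply: contraNneq it => e; apply/eqP/val_inj.
Qed.

Lemma pihomogM0 f d g t : f \is d.-homog -> (t < d)%N -> pihomog mdeg t (g * f) = 0.
Proof.
move=> fd td; have [N /(_ N (leqnn _)) ->] := pihomog_sum g.
rewrite big_distrl /= raddf_sum /= big1 // => i _.
apply: (@pihomog_ne0 _ _ _ (i + d)%N); last by apply: dhomogM => //; exact: pihomogP.
by rewrite neq_ltn orbC (leq_trans td) // leq_addl.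
Qed.

Lemma add_gen_homog_ideal I f d : homog_ideal I -> f \is d.-homog -> homog_ideal (add_gen I f).
Proof.
move=> hI fd; split; first split.
- by exists 0, 0; rewrite ?mul0r ?addr0 //; exact: ideal0.
- move=> a _ _ [b [g Ig ->]] [c [h Ih ->]].
  exists (a * b + c), (a * g + h); first by apply: idealD => //; exact: idealM.
  by rewrite mulrDr mulrA mulrDl addrACA.
- move=> _ [a [g Ig ->]] t; rewrite raddfD /=.
  have Igt := hI.2 _ Ig t; have [td|dt] := ltnP t d.
    by rewrite (pihomogM0 _ fd td); exists 0, (pihomog mdeg t g); rewrite ?mul0r.
  have -> : pihomog mdeg t (a * f) = pihomog mdeg (t - d)%N a * f.
    by rewrite -{1}(subnK dt) (pihomogM _ _ fd).
  by exists (pihomog mdeg (t - d)%N a), (pihomog mdeg t g).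
Qed.

Lemma colon_homog_ideal I f d : homog_ideal I -> f \is d.-homog -> homog_ideal (colon I f).
Proof.
move=> hI fd; split; first split.
- by rewrite /colon /= mul0r; exact: ideal0.
- move=> a g h Ig Ih; rewrite /colon /= mulrDl -mulrA.
  by apply: idealD => //; exact: idealM.
- by move=> g Ig t; rewrite /colon /= -(pihomogM _ _ fd); apply: hI.2.
Qed.

Lemma sub_add_gen I f : (I `<=` add_gen I f)%classic.
Proof. by move=> g Ig; exists 0, g; rewrite ?mul0r ?add0r. Qed.

Lemma mem_add_gen I f : homog_ideal I -> add_gen I f f.
Proof. by move=> hI; exists 1, 0; rewrite ?mul1r ?addr0 //; exact: ideal0. Qed.

Lemma sub_colon I f : homog_ideal I -> (I `<=` colon I f)%classic.
Proof. by move=> hI g Ig; rewrite /colon /= mulrC; exact: idealM. Qed.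

Section Mult.
Variables (d t : nat) (f : dhomog n.+1 k d).

Definition mul_dhomog (g : dhomog n.+1 k t) : dhomog n.+1 k (t + d)%N :=
  DHomog (dhomogM (dhomog_is_dhomog g) (dhomog_is_dhomog f)).

Lemma mul_dhomog_linear : linear mul_dhomog.
Proof. by move=> a u v; apply/val_inj; rewrite /= mulrDl -scalerAl. Qed.

HB.instance Definition _ := GRing.isLinear.Build k (dhomog n.+1 k t)
  (dhomog n.+1 k (t + d)%N) _ mul_dhomog mul_dhomog_linear.

(** The exact sequence 0 -> (S / (I : f))(-d) -> S / I -> S / (I + f S) -> 0, read on
    dimensions: multiplication by [f] embeds the forms of degree [t] into those of
    degree [t + d], and meets [I] in the image of [I : f]. *)
Lemma hilbert_fun_exact I : homog_ideal I -> f != 0 ->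
  hilbert_fun I (t + d)%N =
    (hilbert_fun (add_gen I f) (t + d)%N + hilbert_fun (colon I f) t)%N.
Proof.
move=> hI f0; have fd : (f : S) \is d.-homog := dhomog_is_dhomog f.
have hJ := add_gen_homog_ideal hI fd; have hQ := colon_homog_ideal hI fd.
have f0' : (f : S) != 0 by apply: contra_neq f0 => f0; apply/val_inj.
pose phi := linfun mul_dhomog.
have phiE (g : dhomog n.+1 k t) : phi g = mul_dhomog g by rewrite lfunE.
have inj_phi : lker phi == 0%VS.
  apply/lker0P => u v; rewrite !phiE => /(congr1 (@mpoly_of_dhomog _ _ _)) /= e.
  by apply/val_inj/(mulIf f0' e).
set A := homog_part I (t + d)%N; set Q := homog_part (colon I f) t.
have JE : homog_part (add_gen I f) (t + d)%N = (A + limg phi)%VS.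
  apply/vspaceP => h; apply/idP/idP.
    move/(homog_partP hJ.1 _) => [a [g Ig hE]].
    have {}hE : mpoly_of_dhomog h = pihomog mdeg t a * f + pihomog mdeg (t + d)%N g.
      have := congr1 (pihomog mdeg (t + d)%N) hE.
      by rewrite raddfD /= (pihomogM _ _ fd) pihomog_dE //; exact: dhomog_is_dhomog.
    apply/memv_addP; exists (DHomog (pihomogP mdeg (t + d)%N g)).
      by apply/(homog_partP hI.1 _) => /=; exact: hI.2.
    exists (phi (DHomog (pihomogP mdeg t a))); first exact: memv_img (memvf _).
    by rewrite phiE; apply/val_inj; rewrite /= hE addrC.
  move/memv_addP => [g /(homog_partP hI.1 _) Ig [_ /memv_imgP [a _ ->] ->]].
  apply/(homog_partP hJ.1 _); rewrite phiE /= addrC.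
  by exists (a : S), (g : S).
have capE : (A :&: limg phi = phi @: Q)%VS.
  apply/vspaceP => h; apply/idP/idP.
    move/memv_capP => [/(homog_partP hI.1 _) Ih /memv_imgP [a _ ha]].
    rewrite ha; apply: memv_img; apply/(homog_partP hQ.1 _).
    by rewrite /colon /=; move: Ih; rewrite ha phiE.
  move=> /memv_imgP [a /(homog_partP hQ.1 _) Qa ->].
  by rewrite memv_cap memv_img ?memvf // andbT; apply/(homog_partP hI.1 _); rewrite phiE.
have := dimv_sum_cap A (limg phi); rewrite -JE capE !limg_dim_eq ?(eqP inj_phi) ?capv0 //.
have arith a b c u v : (a + b = c + v)%N -> (c <= u)%N -> (a <= u)%N -> (b <= v)%N ->
  (u - c = u - a + (v - b))%N by clear; lia.
move=> eq_dim; apply: arith; [exact: eq_dim| | |]; apply/dimvS/subvf.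
Qed.
End Mult.

Lemma hilbert_fun_sub I J t : homog_ideal I -> homog_ideal J -> (I `<=` J)%classic ->
  (hilbert_fun J t <= hilbert_fun I t)%N.
Proof.
move=> hI hJ IJ; rewrite /hilbert_fun leq_sub2l //; apply/dimvS/subvP => f.
by move=> /(homog_partP hI.1 _) /IJ /(homog_partP hJ.1 _).
Qed.

Lemma hilbert_fun_eq0 I t : homog_ideal I ->
  (hilbert_fun I t == 0%N) <-> (forall f, f \is t.-homog -> I f).
Proof.
move=> hI; split=> [|H].
  rewrite /hilbert_fun subn_eq0 => le_dim f ft.
  have /eqP full : homog_part I t == fullv by rewrite eqEdim subvf.
  have := memvf (DHomog ft); rewrite -full; exact: (homog_partP hI.1 (DHomog ft)).1.
rewrite /hilbert_fun subn_eq0; apply/dimvS/subvP => f _.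
by apply/(homog_partP hI.1 _)/H/dhomog_is_dhomog.
Qed.

End HilbertFunction.

(** * The ascending chain condition *)

Section Dickson.

Lemma incr_leq (g : nat -> nat) : (forall i, (g i < g i.+1)%N) ->
  forall i j, (i <= j)%N -> (g i <= g j)%N.
Proof. by move=> g_lt i j; apply: (homo_leq leqnn leq_trans) => l; exact: ltnW. Qed.

Lemma nondecreasing_subseq (u : nat -> nat) : exists phi : nat -> nat,
  (forall i, (phi i < phi i.+1)%N) /\ (forall i j, (i <= j)%N -> (u (phi i) <= u (phi j))%N).
Proof.
have /choice [nxt nxtP] : forall N, exists i,
    (N <= i)%N /\ forall j, (N <= j)%N -> (u i <= u j)%N.
  move=> N; have exv : exists v, `[< exists2 i, (N <= i)%N & u i = v >].
    by exists (u N); apply/asboolP; exists N.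
  case: (ex_minnP exv) => _ /asboolP [i Ni <-] vmin; exists i; split=> // j Nj.
  by apply: vmin; apply/asboolP; exists j.
pose phi := fix phi i := if i is i'.+1 then nxt (phi i').+1 else nxt 0%N.
have phi_lt i : (phi i < phi i.+1)%N by exact: (nxtP _).1.
exists phi; split=> // i j ij.
have phi_le := incr_leq phi_lt ij.
by case: i {ij} phi_le => [|i] phi_le; apply: (nxtP _).2 => //; apply: leq_trans phi_le;
  exact: phi_lt.
Qed.

Lemma dickson n (f : nat -> 'X_{1..n}) : exists i j, (i < j)%N /\ (f i <= f j)%MM.
Proof.
suff [phi [phi_lt phiP]] : exists phi : nat -> nat, (forall i, (phi i < phi i.+1)%N) /\
    forall c, c \in enum 'I_n -> forall i j, (i <= j)%N -> (f (phi i) c <= f (phi j) c)%N.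
  exists (phi 0%N), (phi 1%N); split=> //; apply/mnm_lepP => c.
  by apply: phiP; rewrite ?mem_enum.
elim: (enum 'I_n) => [|c cs [phi [phi_lt phiP]]]; first by exists id.
have [psi [psi_lt psiP]] := nondecreasing_subseq (fun i => f (phi i) c).
exists (phi \o psi); split=> [i|c'] /=.
  by apply: leq_trans (incr_leq phi_lt (psi_lt i)).
rewrite inE => /predU1P [->|c'cs] i j ij; first exact: psiP.
by apply: phiP => //; exact: incr_leq.
Qed.
End Dickson.

Section Noetherian.
Variables (k : fieldType) (n : nat).
Local Notation S := {mpoly k[n]}.

Lemma mlead_sub_lt (p q : S) : mlead p = mlead q -> p@_(mlead p) = q@_(mlead q) ->
  p - q != 0 -> (mlead (p - q) < mlead p)%O.
Proof.
move=> epq ec pq0; rewrite lt_neqAle; apply/andP; split.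
  apply: contra_neq pq0 => e; apply/eqP; rewrite -mleadc_eq0 e mcoeffB.
  by rewrite [X in _ - _@_X]epq ec subrr.
by apply: le_trans (mleadB_le p q) _; rewrite epq joinxx.
Qed.

(** Otherwise the axiom of choice gives a strictly increasing sequence of ideals, and
    in each step a new polynomial of least leading monomial. By Dickson's lemma one
    of these monomials divides a later one, and the reduction of the later
    polynomial by the earlier one contradicts minimality. *)
Lemma noetherian (Phi : set S -> Prop) (I0 : set S) :
  (forall I, Phi I -> is_ideal I) -> Phi I0 ->
  exists M, [/\ Phi M, (I0 `<=` M)%classic
    & forall J, Phi J -> (M `<=` J)%classic -> J = M].
Proof.
move=> Phi_ideal Phi0; apply: contrapT => noM.
have /choice [nxt nxtP] : forall M, exists J, Phi M -> (I0 `<=` M)%classic ->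
    [/\ Phi J, (M `<=` J)%classic & exists f, J f /\ ~ M f].
  move=> M; have [[PhiM IM]|nM] := pselect (Phi M /\ (I0 `<=` M)%classic); last first.
    by exists M => ? ?; case: nM.
  have [J [PhiJ MJ JM]] : exists J, [/\ Phi J, (M `<=` J)%classic & J <> M].
    apply: contrapT => noJ; apply: noM; exists M; split=> // J PhiJ MJ.
    by apply: contrapT => JM; apply: noJ; exists J.
  exists J => _ _; split=> //; apply: contrapT => nof; apply: JM.
  by apply/seteqP; split=> // f Jf; apply: contrapT => Mf; apply: nof; exists f.
pose I i := iter i nxt I0.
have IP i : Phi (I i) /\ (I0 `<=` I i)%classic.
  elim: i => [|i [Phii Ii]]; first by split.
  by have [PhiJ IJ _] := nxtP _ Phii Ii; split=> //; exact: subset_trans IJ.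
have Isub i j : (i <= j)%N -> (I i `<=` I j)%classic.
  elim: j => [|j IH]; first by rewrite leqn0 => /eqP ->.
  rewrite leq_eqVlt => /predU1P [->//|/IH Iij].
  by have [_ IJ _] := nxtP _ (IP j).1 (IP j).2; exact: subset_trans IJ.
have /choice [f fP] : forall i, exists f, [/\ I i.+1 f, ~ I i f
    & forall g, I i.+1 g -> ~ I i g -> ~ (mlead g < mlead f)%O].
  move=> i; have [_ _ [f [If nIf]]] := nxtP _ (IP i).1 (IP i).2.
  elim/(well_founded_ind (@ltom_wf n)): (mlead f) {-2}f (erefl (mlead f)) If nIf
    => m IH g gm Ig nIg.
  have [[h [Ih nIh hg]]|noh] :=
    pselect (exists h, [/\ I i.+1 h, ~ I i h & (mlead h < mlead g)%O]).
    by apply: (IH (mlead h) _ h) => //; rewrite -gm.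
  by exists g; split=> // h Ih nIh hg; apply: noh; exists h.
have f0 i : f i != 0.
  have [_ nIf _] := fP i; apply/eqP => fi0; apply: nIf; rewrite fi0.
  by case: (Phi_ideal _ (IP i).1).
have [i [j [ij mij]]] := dickson (fun i => mlead (f i)).
have [Ii _ _] := fP i; have [Ij nIj jmin] := fP j.
pose c := (f j)@_(mlead (f j)) / (f i)@_(mlead (f i)).
have ci0 : (f i)@_(mlead (f i)) != 0 by rewrite mleadc_eq0.
have c0 : c != 0 by rewrite mulf_neq0 ?invr_eq0 // mleadc_eq0.
pose m := (mlead (f j) - mlead (f i))%MM.
pose q := c *: (f i * 'X_[m]).
have Iq l : (i < l)%N -> I l q.
  move=> il; have [I0' ID] := Phi_ideal _ (IP l).1.
  rewrite /q -mul_mpolyC mulrA mulrAC -[_ * _]addr0; apply: ID => //.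
  exact: Isub il _ Ii.
have X0 : 'X_[m] != 0 :> S by rewrite -msize_poly_eq0 msizeX.
have qlead : mlead q = mlead (f j).
  by rewrite /q mleadZ // mleadM // mleadXm addmC submK.
have qc : q@_(mlead q) = (f j)@_(mlead (f j)).
  rewrite qlead /q mcoeffZ -{1}(submK mij) -/m.
  by rewrite mcoeffMX /c divfK.
have g_in : I j.+1 (f j - q).
  have [_ ID] := Phi_ideal _ (IP j.+1).1.
  by rewrite addrC -mulN1r; apply: ID => //; apply: Iq; exact: ltnW.
have g_notin : ~ I j (f j - q).
  move=> Ig; apply: nIj; have [_ ID] := Phi_ideal _ (IP j).1.
  by rewrite -(subrK q (f j)) -[f j - q]mul1r; apply: ID => //; exact: Iq.
apply: (jmin _ g_in g_notin); apply: mlead_sub_lt; [by rewrite qlead|by rewrite qc|].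
by apply/eqP => g0; apply: g_notin; rewrite g0; case: (Phi_ideal _ (IP j).1).
Qed.
End Noetherian.

(** * Primes as maximal ideals *)

Section Primes.
Variables (k : fieldType) (n : nat).
Local Notation S := {mpoly k[n.+1]}.
Implicit Types (I J P Q : set S) (f g h : S) (t d : nat).

Lemma pihomog_large f d : (msize f <= d)%N -> pihomog mdeg d f = 0.
Proof.
move=> fd; rewrite (pihomog_partitionE (leqnn (msize f))) raddf_sum /= big1 // => i _.
apply: (@pihomog_ne0 _ _ _ i); last exact: pihomogP.
by rewrite neq_ltn (leq_trans (ltn_ord i) fd).
Qed.

Lemma pihomog_topM f g s t : (msize f <= s.+1)%N -> (msize g <= t.+1)%N ->
  pihomog mdeg (s + t)%N (f * g) = pihomog mdeg s f * pihomog mdeg t g.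
Proof.
move=> fs gt; rewrite {1}(pihomog_partitionE gt) mulr_sumr raddf_sum /=.
have E (i : 'I_t.+1) : pihomog mdeg (s + t)%N (f * pihomog mdeg i g) =
    pihomog mdeg (s + t - i)%N f * pihomog mdeg i g.
  have it : (i <= s + t)%N by apply: leq_trans (leq_addl _ _); rewrite -ltnS.
  by rewrite -{1}(subnK it) (pihomogM _ _ (pihomogP mdeg i g)).
rewrite big_ord_recr /= big1 ?add0r => [|i _].
  by have := E ord_max; rewrite /= addnK.
have := E (widen_ord (leqnSn t) i); rewrite /= => ->.
rewrite pihomog_large ?mul0r //; apply: leq_trans fs _.
by have := ltn_ord i; lia.
Qed.

Lemma msize_drop_top f s : (msize f <= s.+1)%N -> (msize (f - pihomog mdeg s f) <= s)%N.
Proof.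
move=> fs; rewrite {1}(pihomog_partitionE fs) big_ord_recr /= addrK.
apply: leq_trans (msize_sum _ _ _) _; apply/bigmax_leqP => i _.
rewrite msizeE; apply/bigmax_leqP_seq => m mi _.
by have /dhomogP -> := pihomogP mdeg i f.
Qed.

(** Induction on the sizes: the top form of a product is the product of the top
    forms, so that the top form of one factor is in [Q] and can be removed. *)
Lemma prime_of_homog Q : homog_ideal Q ->
  (forall d t f g, f \is d.-homog -> g \is t.-homog -> Q (f * g) -> Q f \/ Q g) ->
  forall f g, Q (f * g) -> Q f \/ Q g.
Proof.
move=> hQ primeQ f g.
have [N] : exists N, (msize f + msize g < N)%N by exists (msize f + msize g).+1.
elim: N f g => // N IH f g; rewrite ltnS => fgN Qfg.
have [->|f0] := eqVneq f 0; first by left; exact: ideal0.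
have [->|g0] := eqVneq g 0; first by right; exact: ideal0.
have fs : msize f = (msize f).-1.+1 by apply: mpolySpred.
have gs : msize g = (msize g).-1.+1 by apply: mpolySpred.
set s := (msize f).-1 in fs; set t := (msize g).-1 in gs.
have := hQ.2 _ Qfg (s + t)%N; rewrite pihomog_topM -?fs -?gs //.
move/(primeQ _ _ _ _ (pihomogP mdeg s f) (pihomogP mdeg t g)) => [Qfs|Qgt].
  have := IH (f - pihomog mdeg s f) g; case.
  - apply: leq_trans fgN; rewrite ltn_add2r fs ltnS; apply: msize_drop_top.
    by rewrite -fs.
  - rewrite mulrBl; apply: idealB => //; rewrite mulrC; exact: idealM.
  - by move=> Qf; left; rewrite -(subrK (pihomog mdeg s f) f); exact: idealD.
  - by right.
have := IH f (g - pihomog mdeg t g); case.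
- apply: leq_trans fgN; rewrite ltn_add2l gs ltnS; apply: msize_drop_top.
  by rewrite -gs.
- rewrite mulrBr; apply: idealB => //; exact: idealM.
- by left.
- by move=> Qg; right; rewrite -(subrK (pihomog mdeg t g) g); exact: idealD.
Qed.

Lemma mem_all_vars I : homog_ideal I -> (forall i, I 'X_i) ->
  forall t f, (0 < t)%N -> f \is t.-homog -> I f.
Proof.
move=> hI IX t f t0 /dhomogP ft; rewrite (mpolyE f) big_seq.
apply: ideal_sum => // m /ft mt; rewrite -mul_mpolyC; apply: idealM => //.
have [i mi] : exists i, m i != 0%N.
  apply/existsP; apply: contraTT t0; rewrite negb_exists -leqNgt => /forallP m0.
  have <- : (\sum_j m j = t)%N by rewrite -mdegE.
  by rewrite leqn0 sum_nat_eq0; apply/forallP => j; have := m0 j; rewrite negbK.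
rewrite -(submK (m := U_(i)) (m' := m)) ?lep1mP // mpolyXD.
exact: idealM.
Qed.

Definition homog_prime Q : Prop :=
  [/\ homog_ideal Q, (forall f g, Q (f * g) -> Q f \/ Q g) & exists i : 'I_n.+1, ~ Q 'X_i].

Lemma proj_primeP Q : proj_prime Q <-> homog_prime Q.
Proof.
split=> [[[Q0 Q1 QD] Qprime Qhom [i QXi]]|[hQ Qprime [i QXi]]].
  split; last by exists i.
  - split=> //; split; first by move: Q0; rewrite !inE.
    by move=> a f g Qf Qg; have := QD a f g; rewrite !inE; apply.
  - move=> f g Qfg; have := Qprime f g; rewrite !inE => /(_ Qfg) /orP.
    by rewrite !inE.
split=> //; last by exists i.
- split; first by rewrite !inE; exact: ideal0.
  + rewrite inE /= notin_setE => Q1; apply: QXi.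
    by rewrite -['X_i]mulr1; exact: idealM.
  + by move=> a f g; rewrite !inE => Qf Qg; apply: idealD => //; exact: idealM.
- move=> f g; rewrite !inE => /Qprime [Qf|Qg]; apply/orP; rewrite !inE; tauto.
- exact: hQ.2.
Qed.

(** Classes of functions that contain the Hilbert function in the middle of the exact
    sequence of [hilbert_fun_exact] as soon as they contain the outer ones. *)
Definition additive_class (E : (nat -> nat) -> Prop) : Prop :=
  (forall (h : nat -> nat), (exists N, forall t, (N <= t)%N -> h t = 0%N) -> E h) /\
  (forall d (h h1 h2 : nat -> nat), (forall t, h (t + d)%N = (h1 (t + d) + h2 t)%N) ->
    E h1 -> E h2 -> E h).

(** If [f g] is in [Q] but neither form is, then [Q + f S] and [Q : f] are strictly
    larger than [Q], their Hilbert functions are in [E], and so is that of [Q]. *)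
Lemma maximal_prime E I : additive_class E -> homog_ideal I -> ~ E (hilbert_fun I) ->
  exists Q, [/\ homog_prime Q, (I `<=` Q)%classic, ~ E (hilbert_fun Q)
    & forall J, homog_ideal J -> (Q `<=` J)%classic -> J <> Q -> E (hilbert_fun J)].
Proof.
move=> [E0 Eadd] hI nEI.
have [|Q [[hQ nEQ] IQ Qmax]] := @noetherian k n.+1
  (fun J => homog_ideal J /\ ~ E (hilbert_fun J)) I _ (conj hI nEI).
  by move=> J [[]].
have {}Qmax J : homog_ideal J -> (Q `<=` J)%classic -> J <> Q -> E (hilbert_fun J).
  by move=> hJ QJ JQ; apply: contrapT => nEJ; apply: JQ; exact: Qmax.
exists Q; split=> //; split=> //.
  apply: prime_of_homog => // d t f g fd gt Qfg.
  apply: contrapT => /not_orP [nQf nQg]; apply: nEQ.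
  have f0 : DHomog fd != 0.
    by apply/eqP => /(congr1 val) /= f0; apply: nQf; rewrite f0; exact: ideal0.
  apply: (Eadd d _ (hilbert_fun (add_gen Q f)) (hilbert_fun (colon Q f))).
  - by move=> t'; exact: (hilbert_fun_exact _ hQ f0).
  - apply: Qmax; [exact: add_gen_homog_ideal hQ fd|exact: sub_add_gen|].
    by move=> e; apply: nQf; rewrite -e; exact: mem_add_gen.
  - apply: Qmax; [exact: colon_homog_ideal hQ fd|exact: sub_colon|].
    by move=> e; apply: nQg; rewrite -e /colon /= mulrC.
apply: contrapT => noX; apply: nEQ; apply: E0; exists 1%N => t t0.
apply/eqP/hilbert_fun_eq0 => // f; apply: mem_all_vars => // i.
by apply: contrapT => QXi; apply: noX; exists i.
Qed.

Definition evtl_zero (h : nat -> nat) := exists N, forall t, (N <= t)%N -> h t = 0%N.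
Definition evtl_const (h : nat -> nat) := exists N c, forall t, (N <= t)%N -> h t = c.

Lemma evtl_zero_additive : additive_class evtl_zero.
Proof.
split=> // d h h1 h2 hE [N1 H1] [N2 H2]; exists (N1 + N2 + d)%N => t tN.
have dt : (d <= t)%N by lia.
by rewrite -(subnK dt) hE subnK // H1 ?H2 //; lia.
Qed.

Lemma evtl_const_additive : additive_class evtl_const.
Proof.
split=> [h [N H]|d h h1 h2 hE [N1 [c1 H1]] [N2 [c2 H2]]]; first by exists N, 0%N.
exists (N1 + N2 + d)%N, (c1 + c2)%N => t tN.
have dt : (d <= t)%N by lia.
by rewrite -(subnK dt) hE subnK // H1 ?H2 //; lia.
Qed.

End Primes.

(** * Homogeneous primes of dimension one *)

Section DimOne.
Variables (k : fieldType) (n : nat).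
Local Notation S := {mpoly k[n.+1]}.
Implicit Types (I J P Q : set S) (f g h : S) (t d : nat).

Lemma varX_homog (i : 'I_n.+1) : ('X_i : S) \is 1.-homog.
Proof. by rewrite dhomogX; apply/eqP; exact: mdeg1. Qed.

Lemma colon_prime P f : homog_prime P -> ~ P f -> colon P f = P.
Proof.
move=> [hP Pprime _] nPf; apply/seteqP; split; last exact: sub_colon.
by move=> g /Pprime [].
Qed.

Lemma hilbert_fun_prime P d f t : homog_prime P -> f \is d.-homog -> ~ P f ->
  hilbert_fun P (t + d)%N = (hilbert_fun (add_gen P f) (t + d)%N + hilbert_fun P t)%N.
Proof.
move=> primeP fd nPf; have [hP _ _] := primeP.
have f0 : DHomog fd != 0.
  by apply/eqP => /(congr1 val) /= f0; apply: nPf; rewrite f0; exact: ideal0.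
by rewrite (hilbert_fun_exact t hP f0) /= colon_prime.
Qed.

Lemma hilbert_fun_prime_gt0 P t : homog_prime P -> (0 < hilbert_fun P t)%N.
Proof.
move=> [hP Pprime [i PXi]]; rewrite lt0n; apply/negP => /hilbert_fun_eq0 - /(_ hP) PS.
have : P ('X_i ^+ t).
  by apply: PS; rewrite -[t in t.-homog]mul1n; apply: dhomogMn; exact: varX_homog.
elim: t {PS} => [|t IH].
  by rewrite expr0 => P1; apply: PXi; rewrite -['X_i]mulr1; apply: idealM.
by rewrite exprS => /Pprime [].
Qed.

(** Let [I] be the ideal generated by [P] and a variable outside [P]. Were its Hilbert
    function not eventually constant, [maximal_prime] would give a prime [Q] above
    [I] that is maximal with this property; adding to it a variable outside [Q]
    leaves a Hilbert function that is eventually constant but not zero, hence there is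
    a further prime, and with [P] a chain of length two. So the increments of the
    Hilbert function of [P] are eventually equal to some [e]. A prime strictly above
    [P] forces growth, and [e > 0]. *)
Lemma hilbert_fun_dim1 P : proj_prime P -> has_dim P 1 ->
  exists e N, (0 < e)%N /\ forall t, (N <= t)%N ->
    hilbert_fun P t.+1 = (hilbert_fun P t + e)%N.
Proof.
move=> /proj_primeP primeP [[c [c0 cprime clt]] ndim2].
have [hP Pprime [i PXi]] := primeP.
have Xi1 := varX_homog i.
have stepP t : hilbert_fun P t.+1 = (hilbert_fun (add_gen P 'X_i) t.+1 + hilbert_fun P t)%N.
  by have := hilbert_fun_prime t primeP Xi1 PXi; rewrite addn1.
have hI := add_gen_homog_ideal hP Xi1.
have [N [e He]] : evtl_const (hilbert_fun (add_gen P 'X_i)).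
  apply: contrapT => nconst.
  have [Q [primeQ IQ nQ Qmax]] := maximal_prime (evtl_const_additive) hI nconst.
  have [hQ Qprime [j QXj]] := primeQ; have Xj1 := varX_homog j.
  have hJ := add_gen_homog_ideal hQ Xj1.
  have [|N [e He]] := Qmax _ hJ (@sub_add_gen _ _ Q 'X_j).
    by move=> eJ; apply: QXj; rewrite -eJ; exact: mem_add_gen.
  have stepQ t : hilbert_fun Q t.+1 = (hilbert_fun (add_gen Q 'X_j) t.+1 + hilbert_fun Q t)%N.
    by have := hilbert_fun_prime t primeQ Xj1 QXj; rewrite addn1.
  have nzero : ~ evtl_zero (hilbert_fun (add_gen Q 'X_j)).
    move=> [N' H]; apply: nQ; exists N', (hilbert_fun Q N') => t.
    elim: t => [|t IH]; first by rewrite leqn0 => /eqP ->.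
    rewrite leq_eqVlt => /predU1P [<-//|N't].
    by rewrite stepQ H ?IH // ltnW.
  have [Q' [primeQ' JQ' _ _]] := maximal_prime (evtl_zero_additive) hJ nzero.
  have PI := @sub_add_gen _ _ P 'X_i; have QJ := @sub_add_gen _ _ Q 'X_j.
  apply: ndim2; exists (fun l => if l is l'.+1 then if l' is 0 then Q else Q' else P).
  split=> // [[|[|l]] _|[|[|l]]] //; try by apply/proj_primeP.
    move=> _; split; first exact: subset_trans PI IQ.
    by move=> QP; apply/PXi/QP/IQ; exact: mem_add_gen.
  move=> _; split; first exact: subset_trans QJ JQ'.
  by move=> Q'Q; apply/QXj/Q'Q/JQ'; exact: mem_add_gen.
exists e, N; split; last by move=> t Nt; rewrite stepP He 1?addnC // leqW.
rewrite lt0n; apply/eqP => e0; rewrite {e}e0 in He.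
have constP t : (N <= t)%N -> hilbert_fun P t = hilbert_fun P N.
  elim: t => [|t IH]; first by rewrite leqn0 => /eqP ->.
  rewrite leq_eqVlt => /predU1P [<-//|Nt].
  by rewrite stepP He ?IH // ltnW.
have /proj_primeP primeQ := cprime 1%N isT; set Q := c 1%N in primeQ.
have [PQ nQP] : (P `<` Q)%classic by rewrite -c0; exact: clt.
have [f Qf nPf] : exists2 f, Q f & ~ P f.
  by apply: contrapT => H; apply: nQP => f Qf; apply: contrapT => nPf; apply: H; exists f.
have [hQ _ _] := primeQ.
have [d nPfd] : exists d, ~ P (pihomog mdeg d f).
  apply: contrapT => noD; apply: nPf.
  rewrite (pihomog_partitionE (leqnn (msize f))); apply: ideal_sum => // d _.
  by apply: contrapT => nPd; apply: noD; exists (d : nat).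
have fd := pihomogP mdeg d f.
have hJ := add_gen_homog_ideal hP fd.
have := hilbert_fun_prime N primeP fd nPfd; rewrite constP ?leq_addr //.
have : (hilbert_fun Q (N + d) <= hilbert_fun (add_gen P (pihomog mdeg d f)) (N + d))%N.
  apply: hilbert_fun_sub => // _ [a [g Pg ->]].
  by apply: idealD => //; [apply: idealM => //; exact: hQ.2|exact: PQ].
have := hilbert_fun_prime_gt0 (N + d)%N primeQ; clear; lia.
Qed.

Lemma irr_degree_dim1 P e N : (0 < e)%N ->
  (forall t, (N <= t)%N -> hilbert_fun P t.+1 = (hilbert_fun P t + e)%N) ->
  irr_degree P = e%:R.
Proof.
move=> e0 step; pose c : rat := (hilbert_fun P N)%:R - e%:R * N%:R.
pose p : {poly rat} := e%:R%:P * 'X + c%:P.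
have hp : is_hilbert_poly P p.
  exists N => t Nt; rewrite hornerD hornerM !hornerC hornerX /c -(subnKC Nt).
  move: (t - N)%N => {t Nt} t; elim: t => [|t IH]; first by rewrite addn0 addrC subrK.
  rewrite addnS step ?leq_addr // natrD -IH -addn1 natrD mulrDr mulr1.
  by rewrite [LHS]addrAC.
have hE : hilbert_poly P = p.
  apply: is_hilbert_poly_uniq (hp).
  exact: (@xgetPex _ 0 [set q | is_hilbert_poly P q]%classic (ex_intro _ p hp)).
have e0' : e%:R != 0 :> rat by rewrite pnatr_eq0 -lt0n.
rewrite /irr_degree hE lead_coefE size_MXaddC polyC_eq0 (negPf e0') /=.
by rewrite size_polyC e0' coefD coefMX !coefC addr0 mul1r.
Qed.
End DimOne.

(** * Points and Hilbert functions *)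

Section Points.
Variable n : nat.
Local Notation S := {mpoly rat[n.+1]}.
Implicit Types (f g : S) (u v x : 'rV[int]_n.+1).

Definition eval_at x f : rat := f.@[fun i => (x 0 i)%:~R].

Lemma eval_sep u v : ~~ parallel u v ->
  exists f, [/\ f \is 1.-homog, eval_at v f = 0 & eval_at u f != 0].
Proof.
move=> /forallPn [a /forallPn [b uv]].
exists ((v 0 b)%:~R *: 'X_a - (v 0 a)%:~R *: 'X_b); split.
- by rewrite rpredB ?rpredZ ?varX_homog.
- by rewrite /eval_at mevalB !mevalZ !mevalXU mulrC subrr.
rewrite /eval_at mevalB !mevalZ !mevalXU subr_eq0 -!intrM eqr_int.
by rewrite mulrC [v 0 a * _]mulrC.
Qed.

Lemma eval_neq0 u : u != 0 -> exists f, f \is 1.-homog /\ eval_at u f != 0.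
Proof.
move=> u0; have [i ui] := supnorm_attained u0; exists 'X_i; split; first exact: varX_homog.
by rewrite /eval_at mevalXU intr_eq0 -absz_eq0 ui supnorm_eq0.
Qed.

(** The product of linear forms that separate [u] from the points of [Y], times a
    power of a linear form that does not vanish at [u]. *)
Lemma eval_interp (Y : seq 'rV[int]_n.+1) u t : u != 0 -> (size Y <= t)%N ->
  all (fun v => ~~ parallel u v) Y ->
  exists f, [/\ f \is t.-homog, eval_at u f != 0 & forall v, v \in Y -> eval_at v f = 0].
Proof.
move=> u0; elim: Y t => [|v Y IH] t /=.
  move=> _ _; have [f [f1 fu]] := eval_neq0 u0; exists (f ^+ t); split=> //.
    by rewrite -[t in t.-homog]mul1n; exact: dhomogMn.
  by rewrite /eval_at rmorphXn expf_neq0.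
case: t => // t; rewrite ltnS => Yt /andP [uv uY].
have [f [ft fu fY]] := IH t Yt uY; have [g [g1 gv gu]] := eval_sep uv.
exists (g * f); split.
- exact: (dhomogM g1 ft).
- by rewrite /eval_at mevalM mulf_neq0.
- move=> w; rewrite inE /eval_at mevalM => /predU1P [->|wY].
    by rewrite -/(eval_at v g) gv mul0r.
  by rewrite -/(eval_at w f) fY // mulr0.
Qed.

Lemma proj_seq_nparallel (X : seq 'rV[int]_n.+1) u v : proj_seq X ->
  u \in X -> v \in X -> u != v -> ~~ parallel u v.
Proof.
move=> /andP [_]; elim: X => [//|x X IH] /= /andP [/allP xX pX]; rewrite !inE.
move=> /predU1P [->|uX] /predU1P [->|vX] uv; first by rewrite eqxx in uv.
- exact: xX.
- by rewrite parallel_sym; exact: xX.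
- exact: IH.
Qed.

(** Evaluation at the points of [X] is onto in degrees at least [size X], by
    interpolation, and kills [J]. *)
Lemma points_le_hilbert (J : set S) (X : seq 'rV[int]_n.+1) t : homog_ideal J ->
  proj_seq X -> (forall x f, x \in X -> J f -> eval_at x f = 0) -> (size X <= t)%N ->
  (size X <= hilbert_fun J t)%N.
Proof.
move=> hJ pX JX Xt; have uX := proj_seq_uniq pX.
pose N := size X; pose pt (j : 'I_N) := nth 0 X j.
have ptX j : pt j \in X by exact: mem_nth.
pose eval_pts (f : dhomog n.+1 rat t) : 'rV[rat]_N := \row_j eval_at (pt j) f.
have eval_pts_lin : linear eval_pts.
  by move=> a f g; apply/rowP => j; rewrite !mxE /eval_at mevalD mevalZ.
pose eval_lin : {linear dhomog n.+1 rat t -> 'rV[rat]_N} :=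
  HB.pack eval_pts (GRing.isLinear.Build _ _ _ _ eval_pts eval_pts_lin).
pose phi := linfun eval_lin.
have phiE (f : dhomog n.+1 rat t) : phi f = eval_pts f by rewrite lfunE.
have interp (j : 'I_N) : exists f : dhomog n.+1 rat t,
    eval_at (pt j) f != 0 /\ forall i, i != j -> eval_at (pt i) f = 0.
  have [||f [ft fj fY]] := @eval_interp (rem (pt j) X) (pt j) t (proj_seq_neq0 pX (ptX j)).
  - by rewrite size_rem // (leq_trans (leq_pred _)).
  - apply/allP => v; rewrite (rem_filter _ uX) mem_filter => /andP [/= vj vX].
    by apply: (proj_seq_nparallel pX (ptX j) vX); rewrite eq_sym.
  exists (DHomog ft); split=> // i ij; apply: fY.
  by rewrite (rem_filter _ uX) mem_filter /= ptX andbT nth_uniq.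
have full : limg phi = fullv.
  apply/vspaceP => w; rewrite memvf.
  have [f fP] := choice interp.
  have -> : w = \sum_j (w 0 j / eval_at (pt j) (f j)) *: phi (f j).
    apply/rowP => i; rewrite summxE (bigD1 i) //= big1 ?addr0.
      by rewrite phiE !mxE divfK //; exact: (fP i).1.
    by move=> j ji; rewrite phiE !mxE ((fP j).2 i) 1?eq_sym // mulr0.
  by apply: memv_suml => j _; apply: memvZ; exact: memv_img (memvf _).
have dimN : \dim (limg phi) = N.
  by rewrite full dimvf /dim /= mul1n.
have sub_ker : (homog_part J t <= lker phi)%VS.
  apply/subvP => f /(homog_partP hJ.1 _) Jf; rewrite memv_ker phiE.
  by apply/eqP/rowP => j; rewrite !mxE JX.
by rewrite /hilbert_fun -(limg_ker_dim phi fullv) capfv dimN addnC -addnBA ?leq_addr ?dimvS.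
Qed.
End Points.

(** * Components through a point *)

Section Components.
Variable n : nat.
Local Notation S := {mpoly rat[n.+1]}.
Implicit Types (f g : S) (u v x : 'rV[int]_n.+1) (I P Q : set S).

(** Vanishing is asked of every graded piece, which makes the ideal homogeneous. *)
Definition point_ideal u : set S :=
  [set f | forall d, eval_at u (pihomog mdeg d f) = 0]%classic.

Lemma point_idealE u f d : f \is d.-homog -> point_ideal u f <-> eval_at u f = 0.
Proof.
move=> fd; split=> [/(_ d)|fu t]; first by rewrite pihomog_dE.
have [->|td] := eqVneq t d; first by rewrite pihomog_dE.
by rewrite (pihomog_ne0 _ fd) 1?eq_sym // /eval_at meval0.
Qed.

Lemma point_ideal_prime u : u != 0 -> homog_prime (point_ideal u).
Proof.
move=> u0; have hM : homog_ideal (point_ideal u).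
  split; first split.
  - by move=> d; rewrite /eval_at raddf0 meval0.
  - move=> a f g Mf Mg d; rewrite /eval_at raddfD /= mevalD.
    rewrite -/(eval_at u _) -/(eval_at u _) Mg addr0.
    rewrite {1}(pihomog_partitionE (leqnn (msize f))) mulr_sumr raddf_sum /=.
    rewrite /eval_at rmorph_sum /=.
    rewrite big1 // => i _; have fi := pihomogP mdeg i f.
    have [di|id] := ltnP d i; first by rewrite (pihomogM0 _ fi di) meval0.
    by rewrite -(subnK id) (pihomogM _ _ fi) mevalM -/(eval_at u (pihomog mdeg i f)) Mf mulr0.
  - by move=> f Mf t; apply/(point_idealE _ (pihomogP mdeg t f)).
split=> //.
  apply: prime_of_homog => // d t f g fd gt.
  move/(point_idealE _ (dhomogM fd gt)); rewrite /eval_at mevalM => /eqP; rewrite mulf_eq0.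
  move=> /orP [/eqP fu|/eqP gu].
    by left; apply/(point_idealE _ fd).
  by right; apply/(point_idealE _ gt).
have [i ui] := supnorm_attained u0; exists i => /(point_idealE _ (varX_homog rat i)).
rewrite /eval_at mevalXU => /eqP; rewrite intr_eq0 -absz_eq0 ui supnorm_eq0.
exact/negP.
Qed.

(** Zorn's lemma for reverse inclusion: the intersection of a chain of primes is
    prime, and it stays proper because it lies below [M]. *)
Lemma minimal_prime_below I M : homog_prime M -> (I `<=` M)%classic ->
  exists P, [/\ components I P & (P `<=` M)%classic].
Proof.
move=> primeM IM.
pose T := {P : set S | [/\ homog_prime P, (I `<=` P)%classic & (P `<=` M)%classic]}.
pose R (P Q : T) := `[< (sval Q `<=` sval P)%classic >].
have [|||A totA|[P [primeP IP PM]] minP] := @Zorn T R.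
- by move=> t; apply/asboolP.
- by move=> r s t /asboolP rs /asboolP st; apply/asboolP; exact: subset_trans rs.
- by move=> [P HP] [Q HQ] /asboolP /= QP /asboolP /= PQ; apply/eq_exist/seteqP.
- have [[P0 AP0]|noA] := pselect (exists P : T, A P); last first.
    by exists (exist _ M (And3 primeM IM (@subset_refl _ M))) => s As; case: noA; exists s.
  pose N : set S := [set f | forall P : T, A P -> sval P f]%classic.
  have [[hP0 _ _] IP0 P0M] := svalP P0.
  suff HN : [/\ homog_prime N, (I `<=` N)%classic & (N `<=` M)%classic].
    by exists (exist _ N HN) => s As; apply/asboolP => f; apply.
  split; last by move=> f /(_ _ AP0) /P0M.
    split; first split; first split.
    + by move=> P AP; have [[hP _ _] _ _] := svalP P; exact: ideal0.
    + move=> a f g Nf Ng P AP; have [[hP _ _] _ _] := svalP P.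
      by apply: idealD => //; [apply: idealM|apply: Ng] => //; exact: Nf.
    + by move=> f Nf t P AP; have [[hP _ _] _ _] := svalP P; apply: hP.2; exact: Nf.
    + move=> f g Nfg; apply: contrapT => /not_orP [nf ng].
      have [P [AP nPf]] : exists P : T, A P /\ ~ sval P f.
        apply: contrapT => H; apply: nf => P AP.
        by apply: contrapT => nPf; apply: H; exists P.
      have [Q [AQ nQg]] : exists Q : T, A Q /\ ~ sval Q g.
        apply: contrapT => H; apply: ng => Q AQ.
        by apply: contrapT => nQg; apply: H; exists Q.
      have [[_ Pprime _] _ _] := svalP P; have [[_ Qprime _] _ _] := svalP Q.
      have [/asboolP QP|/asboolP PQ] := totA _ _ AP AQ.
        by have [/QP|] := Qprime _ _ (Nfg _ AQ).
      by have [|/PQ] := Pprime _ _ (Nfg _ AP).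
    + by have [_ _ [i Mi]] := primeM; exists i => /(_ _ AP0) /P0M.
  by move=> f If P AP; have [_ IP _] := svalP P; exact: IP.
exists P; split=> //; split=> //; first exact/proj_primeP.
move=> Q /proj_primeP primeQ IQ QP.
have := minP (exist _ Q (And3 primeQ IQ (subset_trans QP PM))).
by move=> /(_ (asboolT QP)) [].
Qed.

Definition lin_form (b : 'rV[int]_n.+1) : S := \sum_i (b 0 i)%:~R *: 'X_i.

Lemma lin_form_homog b : lin_form b \is 1.-homog.
Proof. by apply: rpred_sum => i _; rewrite rpredZ ?varX_homog. Qed.

Lemma eval_lin_form b u : eval_at u (lin_form b) = (dot b u)%:~R.
Proof.
rewrite /eval_at /lin_form raddf_sum /= rmorph_sum; apply: eq_bigr => i _ /=.
by rewrite mevalZ mevalXU rmorphM.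
Qed.

Lemma lin_formZ a b : lin_form (a *: b) = a%:~R *: lin_form b.
Proof. by rewrite scaler_sumr; apply: eq_bigr => i _; rewrite mxE intrM scalerA. Qed.

End Components.

(** A plane that does not contain [P] cuts it in an ideal whose Hilbert function is
    eventually the increment [e P] of that of [P], and [points_le_hilbert] bounds the
    number of its points. *)
Lemma components_incidence I (s : seq (set {mpoly rat[4]})) (e : set {mpoly rat[4]} -> nat) :
  (forall P, P \in s -> components I P /\ (0 < e P)%N /\ exists N, forall t, (N <= t)%N ->
     hilbert_fun P t.+1 = (hilbert_fun P t + e P)%N) ->
  incidence s e (fun P u => `[< forall f, P f -> eval_at u f = 0 >])
    (fun P b => `[< P (lin_form b) >]).
Proof.
move=> Hs.
have prime_s P : P \in s -> homog_prime P.
  by move=> /Hs [[/proj_primeP]].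
split.
- by move=> P /Hs [_ []].
- move=> P b x Ps /asboolP Pb /asboolP /(_ _ Pb); rewrite eval_lin_form => /eqP.
  by rewrite intr_eq0 => /eqP.
- move=> P b X Ps /asboolP nPb pX /allP VX /allP bX.
  have primeP := prime_s P Ps; have [hP _ _] := primeP.
  have [_ [_ [N HN]]] := Hs P Ps; have b1 := lin_form_homog b.
  have := hilbert_fun_prime (N + size X) primeP b1 nPb.
  rewrite addn1 HN ?leq_addr // addnC => /addIn eE.
  rewrite eE; apply: points_le_hilbert => //; first exact: add_gen_homog_ideal hP b1.
    move=> x f xX [a [g Pg ->]]; have /asboolP /(_ _ Pg) gx := VX x xX.
    rewrite /eval_at mevalD mevalM -/(eval_at x (lin_form b)) -/(eval_at x g) gx eval_lin_form.
    by rewrite (eqP (bX x xX)) mulr0 addr0.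
  by rewrite leqW // leq_addl.
- move=> P b c k l Ps /asboolP Pb k0 kc; apply/asboolP.
  have [hP _ _] := prime_s P Ps.
  have k0' : k%:~R != 0 :> rat by rewrite intr_eq0.
  have -> : lin_form c = ((k%:~R)^-1 * l%:~R)%:MP * lin_form b.
    by rewrite mul_mpolyC -scalerA -lin_formZ -kc lin_formZ scalerA mulVf // scale1r.
  exact: idealM.
Qed.

(** * The bound for curves *)

(** The components have positive degree, so there are finitely many of them: the
    degree of the curve would otherwise be the default value 0 of an infinite sum. *)
Lemma curve_components (C : proj_variety rat 3) (d : nat) :
  (1 <= d)%N -> is_curve C -> curve_degree C = d%:R ->
  exists (s : seq (set {mpoly rat[4]})) (e : set {mpoly rat[4]} -> nat),
  [/\ forall P, components C P -> P \in s,
      forall P, P \in s -> components C P /\ (0 < e P)%N /\ exists N, forall t, (N <= t)%N ->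
        hilbert_fun P t.+1 = (hilbert_fun P t + e P)%N
    & (\sum_(P <- s) e P)%N = d].
Proof.
move=> d1 curveC degC.
have /choice [e eP] : forall P, exists e : nat, components C P ->
    [/\ (0 < e)%N, irr_degree P = e%:R & exists N, forall t, (N <= t)%N ->
        hilbert_fun P t.+1 = (hilbert_fun P t + e)%N].
  move=> P; have [CP|nCP] := pselect (components C P); last by exists 0%N.
  have [primeP _ _] := CP.
  have [e [N [e0 HN]]] := hilbert_fun_dim1 primeP (curveC _ CP).
  by exists e => _; split=> //; [exact: irr_degree_dim1 e0 HN|exists N].
have fin : finite_set (components C `&` @irr_degree rat 3 @^-1` [set~ 0])%classic.
  apply: contrapT => infin; move: degC; rewrite /curve_degree fsbig_dflt // => /esym/eqP.
  by rewrite pnatr_eq0 -leqn0 leqNgt d1.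
pose s := finite_support 0 (components C) (@irr_degree rat 3).
have s_mem P : P \in s -> components C P.
  by rewrite (in_finite_support fin) inE => -[].
exists s, e; split.
- move=> P CP; rewrite (in_finite_support fin) inE; split=> //=.
  have [e0 -> _] := eP P CP; apply/eqP; by rewrite pnatr_eq0 -lt0n.
- by move=> P /s_mem CP; have [e0 _ HN] := eP P CP.
- apply/eqP; rewrite -(eqr_nat rat) -degC natr_sum /curve_degree; apply/eqP.
  by rewrite -/s big_seq [RHS]big_seq; apply: eq_bigr => P /s_mem /eP [].
Qed.

Lemma parallel_line n (u v : 'rV[int]_n.+1) : u != 0 -> v != 0 -> parallel u v ->
  (<[map_mx (intr : int -> rat) u]> <= <[map_mx (intr : int -> rat) v]>)%VS.
Proof.
move=> u0 v0 uv; have [i vi] := supnorm_attained v0.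
have vi0 : (v 0 i)%:~R != 0 :> rat by rewrite intr_eq0 -absz_eq0 vi supnorm_eq0.
apply/vlineP; exists ((u 0 i)%:~R / (v 0 i)%:~R).
apply/rowP => j; rewrite !mxE; apply: (mulfI vi0).
rewrite mulrA [_ * (_ / _)]mulrC divfK // -!intrM.
by move/parallelP: uv => uv; rewrite [in RHS]uv mulrC.
Qed.

Lemma proj_seq_points (R : realType) (C : proj_variety rat 3) (B : R) :
  exists X : seq 'rV[int]_4,
  [/\ size X = #|` fset_set (rat_points C B)|, proj_seq X,
      all (fun x => supnorm x <= Num.truncn B)%N X
    & forall x f, x \in X -> vanishing_ideal C f -> eval_at x f = 0].
Proof.
have /choice [a aP] : forall p : rat_point 3, exists a : 'rV[int]_4, rat_points C B p ->
    [/\ a != 0, val p = <[map_mx (intr : int -> rat) a]>%VS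
      & forall i, `|(a ord0 i)%:~R| <= B].
  move=> p; have [[Cp [a Ha]]|np] := pselect (rat_points C B p); last by exists 0.
  by exists a.
pose s : seq (rat_point 3) := fset_set (rat_points C B).
have sP p : p \in s -> rat_points C B p.
  by rewrite /s in_fset_set ?inE //; exact: finite_rat_points.
have us : uniq s by exact: fset_uniq.
exists (map a s); split; first by rewrite size_map.
- apply/andP; split.
    by apply/allP => _ /mapP [p /sP /aP [a0 _ _] ->].
  rewrite pairwise_map; move: us; rewrite uniq_pairwise.
  apply: (@sub_in_pairwise _ (mem s)); last by apply/allP.
  move=> p q ps qs /=; apply: contraNN => apq; apply/eqP/val_inj.
  have [p0 -> _] := aP p (sP p ps); have [q0 -> _] := aP q (sP q qs).
  apply/eqP; rewrite eqEsubv !parallel_line //.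
  by rewrite parallel_sym.
- apply/allP => _ /mapP [p /sP /aP [a0 _ aB] ->]; apply/supnorm_leP => i.
  have B0 : 0 <= B by exact: le_trans (normr_ge0 _) (aB i).
  by rewrite truncn_ge_nat // pmulrn abszE intr_norm.
- move=> _ f /mapP [p /sP pC ->] Cf; have [a0 pE _] := aP p pC.
  have := pC.1 f Cf (map_mx intr (a p)); rewrite pE memv_line => /(_ isT) <-.
  by rewrite /eval_at; congr (_.@[_]); apply/funext => i; rewrite mxE.
Qed.

Theorem proposition3p6 (R : realType) :
  exists c kappa : R,
  forall (d : nat) (C : proj_variety rat 3) (B : R),
    (1 <= d)%N -> is_curve C -> curve_degree C = d%:R -> 2 <= B ->
    (#|` fset_set (rat_points C B)|)%:R
      <= c * d%:R `^ (3 / 4) * B ^+ 2 * ln B `^ kappa.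
Proof.
have [c0 Hc0] := curve_count.
have ln2 : 0 < ln 2 :> R by rewrite ln_gt0 // ltr1n.
(* The exponent 2 of the logarithm counts the dyadic classes of pairs of minima. *)
exists (c0%:R / ln 2 ^+ 2), 2 => d C B d1 curveC degC B2.
have [s [e [s_all s_comp sum_e]]] := curve_components d1 curveC degC.
have [X [sizeX pX Xm XC]] := proj_seq_points C B.
set m := Num.truncn B in Xm.
have B0 : 0 <= B by apply: le_trans B2.
have mB : m%:R <= B by rewrite truncn_le.
have m2 : (2 <= m)%N by rewrite truncn_ge_nat.
(* D^3 stands for d^(3/4), up to a constant factor. *)
have [D /andP [Dd dD]] := @floor_root 4 d isT.
have D0 : (0 < D)%N.
  by rewrite lt0n; apply: contraTneq dD => ->; rewrite exp1n -leqNgt.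
have dD' : (\sum_(P <- s) e P <= 16 * D ^ 4)%N.
  rewrite sum_e; apply: leq_trans (ltnW dD) _.
  by rewrite -[16%N]/(2 ^ 4)%N -expnMn leq_exp2r //; move: D0; clear; lia.
have cov x : x \in X -> exists2 P, P \in s & `[< forall f, P f -> eval_at x f = 0 >].
  move=> xX; have x0 := proj_seq_neq0 pX xX.
  have primeM := point_ideal_prime x0.
  have IM : (C `<=` point_ideal x)%classic.
    move=> f Cf t; apply: XC => //.
    by case: (C) Cf => I hI Ihom ? ? /= If; exact: Ihom.
  have [P [CP PM]] := minimal_prime_below primeM IM.
  exists P; first exact: s_all.
  apply/asboolP => f /PM Mf.
  rewrite (pihomog_partitionE (leqnn (msize f))) /eval_at rmorph_sum big1 // => i _.
  exact: Mf.
have := Hc0 _ s e _ _ D m X (components_incidence s_comp) D0 m2 dD' pX Xm cov.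
rewrite sizeX -(ler_nat R) => /le_trans; apply.
set L := trunc_log 2 m.
have LB : L%:R * ln 2 <= ln B.
  rewrite mulr_natl -lnXn // ler_ln ?posrE ?exprn_gt0 //; last exact: lt_le_trans B2.
  by apply: le_trans mB; rewrite -natrX ler_nat trunc_logP // ltnW.
have Dd' : (D ^ 3)%:R <= d%:R `^ (3 / 4) :> R.
  have -> : (D ^ 3)%:R = ((D ^ 4)%:R : R) `^ (3 / 4).
    rewrite !natrX -!powR_mulrn ?ler0n // -powRrM.
    by congr (_ `^ _); lra.
  by apply: ge0_ler_powR; [rewrite divr_ge0|rewrite nnegrE ler0n..|rewrite ler_nat].
have lnB0 : 0 <= ln B by apply: le_trans LB; rewrite mulr_ge0 // ltW.
rewrite (powR_mulrn 2 lnB0) (natrM _ c0) (natrM _ (_ * _)) (natrM _ (D ^ 3)).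
rewrite (natrX _ m) (natrX _ L).
have -> : c0%:R / ln 2 ^+ 2 * d%:R `^ (3 / 4) * B ^+ 2 * ln B ^+ 2 =
    c0%:R * (d%:R `^ (3 / 4) * B ^+ 2 * (ln B / ln 2) ^+ 2).
  by rewrite expr_div_n -!mulrA; congr (_ * _); rewrite mulrC -!mulrA.
rewrite ler_wpM2l // ler_pM ?mulr_ge0 ?exprn_ge0 //.
  by rewrite ler_pM ?exprn_ge0 // ler_pXn2r ?nnegrE.
by rewrite ler_pXn2r ?nnegrE ?divr_ge0 ?(ltW ln2) ?ler_pdivlMr.
Qed.
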